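(* Let $\psi$ be a $c$-convex solution of the tropical Monge–Ampère equation $\nu_\psi=\nu$ on $B$ (notation in the context). Then $\psi$ is not $C^{1,1}$ across any of the six singular points $n_{ij}\in B_{\mathrm{sing}}$; that is, for each $i\neq j$, the convex local potential $\psi_{i,j}=(\psi-m_j)\circ q_{i,j}$ fails to have Lipschitz gradient on every neighbourhood of the point $q_{i,j}^{-1}(n_{ij})$.
   Context: Let $m_0=(1,1,1)$, $m_1=(-3,1,1)$, $m_2=(1,-3,1)$, $m_3=(1,1,-3)\in\mathbb{R}^3$, $\Delta$ their convex hull and $A=\partial\Delta$. Let $n_0=(-1,-1,-1)$, $n_1=(1,0,0)$, $n_2=(0,1,0)$, $n_3=(0,0,1)$, $\Delta^\vee$ their convex hull and $B=\partial\Delta^\vee$; $\langle\cdot,\cdot\rangle$ is the standard pairing. Put $m_{ij}=(m_i+m_j)/2$, $n_{ij}=(n_i+n_j)/2$ ($i\ne j$), $A_{\mathrm{sing}}=\{m_{ij}\}$, $B_{\mathrm{sing}}=\{n_{ij}\}$, $A_{\mathrm{reg}}=A\setminus A_{\mathrm{sing}}$, $B_{\mathrm{reg}}=B\setminus B_{\mathrm{sing}}$. Faces: $\sigma_i=\mathrm{Hull}\{m_j:j\neq i\}$, $\tau_i=\mathrm{Hull}\{n_j:j\ne i\}$. Let $S_i=\{m\in A:\langle m,n_i\rangle=\min_j\langle m,n_j\rangle\}$, $T_i=\{n\in B:\langle m_i,n\rangle=\min_j\langle m_j,n\rangle\}$. Affine atlases: on open faces, volume-preserving linear projections to $\mathbb{R}^2$;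 for $i\neq j$ with remaining indices $k<\ell$, on $S_i^\circ$ the chart $p_{i,j}^{-1}(m)=(\langle m,n_j-n_k\rangle,\langle m,n_j-n_\ell\rangle)$, and on $T_i^\circ$ the chart $q_{i,j}^{-1}(n)=\tfrac14(\langle m_k-m_j,n\rangle,\langle m_\ell-m_j,n\rangle)$, which is defined and injective on $\mathrm{Star}(n_i):=B\setminus\tau_i$ with inverse $q_{i,j}$. $\mu$ (resp. $\nu$) is the measure on $A$ (resp. $B$) obtained by pulling back Lebesgue measure through these charts, extended by zero. For bounded $\varphi$ on $A$, $\psi$ on $B$: $\varphi^c(n)=\sup_{m\in A}(\langle m,n\rangle-\varphi(m))$, $\psi^c(m)=\sup_{n\in B}(\langle m,n\rangle-\psi(n))$; $\psi$ is $c$-convex if $\psi^{cc}=\psi$. For $c$-convex $\varphi$ on $A$, $\partial^c\varphi(m)=\{n:\varphi(m)+\varphi^c(n)=\langle m,n\rangle\}$, and the tropical Monge–Ampère measure of $c$-convex $\psi$ on $B$ is $\nu_\psi=(\partial^c\psi^c)_*\mu$. Writing $m_j$ also for the function $n\mapsto\langle m_j,n\rangle$, the function $\psi_{i,j}:=(\psi-m_j)\circ q_{i,j}$ is convex on $q_{i,j}^{-1}(\mathrm{Star}(n_i))$, which contains $q_{i,j}^{-1}(n_{ij})$ in its interior.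
   Formalization: With the given charts μ(A)=32 and ν(B)=2, so ν_ψ=ν has no solution as written; the equation is taken after normalizing both measures to equal total mass: ν_ψ(E)·ν(B)=μ(A)·ν(E) for every closed E in B. *)

(* Defs.v *)
From HB Require Import structures.
From mathcomp Require Import all_boot all_order all_algebra.
From mathcomp Require Import all_classical all_reals all_analysis.
Set Implicit Arguments. Unset Strict Implicit. Unset Printing Implicit Defensive.
Import Order.TTheory GRing.Theory Num.Theory.
Import numFieldNormedType.Exports.
Local Open Scope classical_set_scope.
Local Open Scope ring_scope.

Section Defs.
Variable R : realType.

Definition R3 := (R * R * R)%type.

Definition pt (x y z : R) : R3 := (x, y, z).

Definition dot (a b : R3) : R := a.1.1 * b.1.1 + a.1.2 * b.1.2 + a.2 * b.2.

Definition mv (i : 'I_4) : R3 :=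
  match val i with
  | 0%N => pt 1 1 1
  | 1%N => pt (-3) 1 1
  | 2%N => pt 1 (-3) 1
  | _ => pt 1 1 (-3)
  end.

Definition nv (i : 'I_4) : R3 :=
  match val i with
  | 0%N => pt (-1) (-1) (-1)
  | 1%N => pt 1 0 0
  | 2%N => pt 0 1 0
  | _ => pt 0 0 1
  end.

Definition lincomb (v : 'I_4 -> R3) (t : 'I_4 -> R) : R3 :=
  pt (\sum_(j < 4) t j * (v j).1.1) (\sum_(j < 4) t j * (v j).1.2)
     (\sum_(j < 4) t j * (v j).2).

Definition face (v : 'I_4 -> R3) (i : 'I_4) : set R3 :=
  [set x | exists t : 'I_4 -> R, (forall j, 0 <= t j) /\ t i = 0 /\
           \sum_(j < 4) t j = 1 /\ x = lincomb v t].

Definition simplex_boundary (v : 'I_4 -> R3) : set R3 :=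
  [set x | exists i, face v i x].

Definition Aset : set R3 := simplex_boundary mv.
Definition Bset : set R3 := simplex_boundary nv.

Definition sigma_face (i : 'I_4) : set R3 := face mv i.
Definition tau_face (i : 'I_4) : set R3 := face nv i.

Definition nmid (i j : 'I_4) : R3 :=
  pt (((nv i).1.1 + (nv j).1.1) / 2) (((nv i).1.2 + (nv j).1.2) / 2)
     (((nv i).2 + (nv j).2) / 2).

Definition Star (i : 'I_4) : set R3 := Bset `\` tau_face i.

Definition rest (i j : 'I_4) : seq 'I_4 :=
  [seq x <- enum 'I_4 | (x != i) && (x != j)].
Definition kidx (i j : 'I_4) : 'I_4 := nth ord0 (rest i j) 0.
Definition lidx (i j : 'I_4) : 'I_4 := nth ord0 (rest i j) 1.

Definition pchart (i j : 'I_4) (m : R3) : R * R :=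
  (dot m (nv j) - dot m (nv (kidx i j)), dot m (nv j) - dot m (nv (lidx i j))).

Definition qchart (i j : 'I_4) (n : R3) : R * R :=
  ((dot (mv (kidx i j)) n - dot (mv j) n) / 4,
   (dot (mv (lidx i j)) n - dot (mv j) n) / 4).

Definition qmap (i j : 'I_4) (x : R * R) : R3 :=
  xget (pt 0 0 0) [set n | Star i n /\ qchart i j n = x].

(* S_i and T_i, and the parts where the minimum is attained only at i
   (these differ from the interiors S_i^o, T_i^o by null sets only) *)
Definition Sreg (i : 'I_4) : set R3 :=
  [set m | Aset m /\ forall j, j != i -> dot m (nv i) < dot m (nv j)].
Definition Treg (i : 'I_4) : set R3 :=
  [set n | Bset n /\ forall j, j != i -> dot (mv i) n < dot (mv j) n].

Definition jsel (i : 'I_4) : 'I_4 := if i == ord0 then (inord 1) else ord0.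

Definition leb2 := ((@lebesgue_measure R) \x (@lebesgue_measure R))%E.

Definition muA (S : set R3) : \bar R :=
  (\sum_(i < 4) leb2 [set pchart i (jsel i) m | m in S `&` Sreg i])%E.
Definition nuB (E : set R3) : \bar R :=
  (\sum_(i < 4) leb2 [set qchart i (jsel i) n | n in E `&` Treg i])%E.

Definition ctA (phi : R3 -> R) (n : R3) : R := sup [set dot m n - phi m | m in Aset].
Definition ctB (psi : R3 -> R) (m : R3) : R := sup [set dot m n - psi n | n in Bset].

Definition boundedOn (S : set R3) (f : R3 -> R) := exists M : R, forall x, S x -> `|f x| <= M.

Definition c_convexB (psi : R3 -> R) := forall n, Bset n -> ctA (ctB psi) n = psi n.

Definition c_subdiff (phi : R3 -> R) (m : R3) : set R3 :=
  [set n | Bset n /\ phi m + ctA phi n = dot m n].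

Definition MAmeas (psi : R3 -> R) (E : set R3) : \bar R :=
  muA [set m | Aset m /\ exists n, E n /\ c_subdiff (ctB psi) m n].

Definition psi_loc (psi : R3 -> R) (i j : 'I_4) (x : R * R) : R :=
  psi (qmap i j x) - dot (mv j) (qmap i j x).

Definition lipschitz_gradient_near (f : R * R -> R) (x0 : R * R) (r : R) :=
  exists L : R,
    (forall x, ball x0 r x -> differentiable f x) /\
    (forall x y v, ball x0 r x -> ball x0 r y ->
       `|'d f x v - 'd f y v| <= L * `|x - y| * `|v|).

End Defs.

(* Main.v *)
(* Write [s] and [t] for the barycentric coordinates on A and B, so that
   <m,n> = 1 - 4 \sum_a s_a t_a and both atlases consist of differences of coordinates.
   Suppose the gradient of psi_{i,j} is Lipschitz near n_ij.  In the chart [q_{i,j}] the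
   pairing with a slope m has a convex kink of size s_i(m) along the edge [n_i, n_j], so
   differentiability forces s_i = 0 on the contact set over edge points.  An
   Aleksandrov-McCann comparison of psi with its reflection under the exchange of i and j
   (both solve the same equation and agree at n_ij) gives s_j = 0 at n_ij as well.  By
   monotonicity that slope is then optimal on a whole half of the edge beyond n_ij, where
   the gradient is therefore constant.  A strip of width d along this half edge has mass
   of order d, but the Lipschitz bound sends it into a set of diameter O(d), hence of mass
   O(d^2). *)
Require Import Defs.
From HB Require Import structures.
From mathcomp Require Import all_boot all_order all_algebra all_fingroup.
From mathcomp Require Import all_classical all_reals all_analysis.
From mathcomp Require Import ring lra.
Import Order.TTheory GRing.Theory Num.Theory.
Import numFieldNormedType.Exports.
Local Open Scope classical_set_scope.
Local Open Scope ring_scope.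

Set Implicit Arguments. Unset Strict Implicit. Unset Printing Implicit Defensive.

(** In the chart $q_{i,j}$ only $s_i$ produces a kink, and differentiability puts no condition on
    $s_j$; its vanishing at $n_{ij}$ therefore needs a global argument. Once $s_i=0$, the derivative
    of psi along the edge towards $n_j$ equals $-4s_j$ at $n_{ij}$, and that of the reflected
    potential equals $4s_j$. If $s_j>0$ the two potentials cross transversally at $n_{ij}$, and the
    region where the reflection is larger has mass arbitrarily close to the crossing. The comparison
    of slopes forbids this: all the mass of that region would have to sit on points whose slope is
    shared with the reflection, and these points form a closed set missing $n_{ij}$. The equation is
    applied to closed sets only. Contact images of closed sets are closed by compactness, so
    measurability never rests on almost-everywhere uniqueness of slopes. Masses enter through
    inequalities: a rectangle in one chart from below, finitely many squares from above,
    superadditivity on disjoint closed sets. *)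

Notation o0 := (@Ordinal 4 0 isT).
Notation o1 := (@Ordinal 4 1 isT).
Notation o2 := (@Ordinal 4 2 isT).
Notation o3 := (@Ordinal 4 3 isT).

(** * The four indices *)

Lemma ord4P (a : 'I_4) :
  ((a = o0 \/ a = o1) \/ a = o2)
  \/ a = o3.
Proof.
case: a => [[|[|[|[|n]]]] h] //.
- by left; left; left; exact: val_inj.
- by left; left; right; exact: val_inj.
- by left; right; exact: val_inj.
- by right; exact: val_inj.
Qed.

Lemma uniq4_mem (i j k l a : 'I_4) : uniq [:: i; j; k; l] -> a \in [:: i; j; k; l].
Proof.
move=> u.
have [||_ ->] := @uniq_min_size _ [:: i; j; k; l] (enum 'I_4) u; last by rewrite mem_enum.
  by move=> x _; rewrite mem_enum.
by rewrite size_enum_ord.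
Qed.

Lemma uniq4_sum (V : nmodType) (f : 'I_4 -> V) (i j k l : 'I_4) :
  uniq [:: i; j; k; l] -> \sum_a f a = f i + f j + f k + f l.
Proof.
move=> u; have -> : \sum_a f a = \sum_(a <- enum 'I_4) f a by rewrite big_enum.
have p : perm_eq (enum 'I_4) [:: i; j; k; l].
  apply: uniq_perm => //; first exact: enum_uniq.
  by move=> a; rewrite mem_enum uniq4_mem.
by rewrite (perm_big _ p) /= !big_cons big_nil addr0 !addrA.
Qed.

Lemma uniq4_kl (i j : 'I_4) : i != j -> uniq [:: i; j; kidx i j; lidx i j].
Proof.
move=> ij.
have sr : size (rest i j) = 2%N.
  rewrite /rest size_filter -[count _ _]/(count (predI (predC1 i) (predC1 j)) _).
  have := count_predC (predU (pred1 i) (pred1 j)) (enum 'I_4).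
  have := count_predUI (pred1 i) (pred1 j) (enum 'I_4).
  rewrite !count_uniq_mem ?enum_uniq // !mem_enum size_enum_ord /=.
  rewrite (@eq_in_count _ (predI _ _) pred0) ?count_pred0 ?addn0; last first.
    by move=> a _ /=; case: eqP => //= ->; exact/negbTE.
  move=> -> /=; rewrite (@eq_in_count _ (predC _) (predI (predC1 i) (predC1 j))).
    by case.
  by move=> a _ /=; rewrite negb_or.
have ur : uniq (rest i j) by rewrite filter_uniq // enum_uniq.
have mk : kidx i j \in rest i j by rewrite mem_nth ?sr.
have ml : lidx i j \in rest i j by rewrite mem_nth ?sr.
have kl : kidx i j != lidx i j by rewrite nth_uniq ?sr.
move: mk ml; rewrite !mem_filter => /andP[/andP[ki kj] _] /andP[/andP[li lj] _].
rewrite /= !inE !negb_or ij kl /= (eq_sym i) ki (eq_sym i) li.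
by rewrite (eq_sym j) kj (eq_sym j) lj.
Qed.

(** * Barycentric coordinates and charts of a simplex boundary *)

Section Barycentric.
Variable R : realType.
Implicit Types (x m n : R3 R) (a i j k l : 'I_4).

(* The coordinates dual to the simplex with vertices [w]:
   [bc mv] are barycentric for the vertices [nv], and conversely. *)
Definition bc (w : 'I_4 -> R3 R) a x : R := (1 - dot (w a) x) / 4.

(** Encodes $\langle m_a,n_b\rangle=1-4\delta_{ab}$. Keeping [v] and [w] abstract lets charts and
    masses be treated once and then used for both [A] and [B]. *)
Definition dual_pair (v w : 'I_4 -> R3 R) :=
  [/\ forall t, \sum_b t b = 1 -> forall a, bc w a (lincomb v t) = t a,
      forall x, \sum_a bc w a x = 1 &
      forall x, lincomb v (bc w ^~ x) = x].

Lemma dotC x y : dot x y = dot y x.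
Proof. by rewrite /dot; ring. Qed.

Lemma R3P x y : x.1.1 = y.1.1 -> x.1.2 = y.1.2 -> x.2 = y.2 -> x = y.
Proof. by case: x => [[? ?] ?]; case: y => [[? ?] ?] /= -> -> ->. Qed.

Lemma sum4 (f : 'I_4 -> R) :
  \sum_a f a = f (o0) + f (o1) + f (o2)
             + f (o3).
Proof. by rewrite (@uniq4_sum _ _ (o0) (o1) (o2)
             (o3)). Qed.

Lemma bc_mvE x :
  [/\ bc (@mv R) o0 x = (1 - (x.1.1 + x.1.2 + x.2)) / 4,
      bc (@mv R) o1 x = (1 - (-3 * x.1.1 + x.1.2 + x.2)) / 4,
      bc (@mv R) o2 x = (1 - (x.1.1 - 3 * x.1.2 + x.2)) / 4 &
      bc (@mv R) o3 x = (1 - (x.1.1 + x.1.2 - 3 * x.2)) / 4].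
Proof. by rewrite /bc /dot; split; congr (_ / _); rewrite /=; ring. Qed.

Lemma bc_nvE x :
  [/\ bc (@nv R) o0 x = (1 + x.1.1 + x.1.2 + x.2) / 4,
      bc (@nv R) o1 x = (1 - x.1.1) / 4,
      bc (@nv R) o2 x = (1 - x.1.2) / 4 &
      bc (@nv R) o3 x = (1 - x.2) / 4].
Proof. by rewrite /bc /dot; split; congr (_ / _); rewrite /=; ring. Qed.

Lemma lincomb_mvE t :
  lincomb (@mv R) t = (t o0 - 3 * t o1 + t o2 + t o3, t o0 + t o1 - 3 * t o2 + t o3,
                  t o0 + t o1 + t o2 - 3 * t o3).
Proof. by rewrite /lincomb !sum4; congr (_, _, _); rewrite /=; ring. Qed.

Lemma lincomb_nvE t :
  lincomb (@nv R) t = (t o1 - t o0, t o2 - t o0, t o3 - t o0).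
Proof. by rewrite /lincomb !sum4; congr (_, _, _); rewrite /=; ring. Qed.

Lemma dual_nm : dual_pair (@nv R) (@mv R).
Proof.
split=> [t | x | x].
- rewrite sum4 lincomb_nvE => t1 a; have /= [e0 e1 e2 e3] := bc_mvE (t o1 - t o0, t o2 - t o0, t o3 - t o0).
  by case: (ord4P a) => [[[] | ] | ] ->; rewrite ?(e0, e1, e2, e3); lra.
- by rewrite sum4; have [-> -> -> ->] := bc_mvE x; lra.
- by have [e0 e1 e2 e3] := bc_mvE x; rewrite lincomb_nvE e0 e1 e2 e3; apply: R3P => /=; lra.
Qed.

Lemma dual_mn : dual_pair (@mv R) (@nv R).
Proof.
split=> [t | x | x].
- rewrite sum4 lincomb_mvE => t1 a.
  set x := (X in bc _ _ X); have /= [e0 e1 e2 e3] := bc_nvE x.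
  by case: (ord4P a) => [[[] | ] | ] ->; rewrite ?(e0, e1, e2, e3); lra.
- by rewrite sum4; have [-> -> -> ->] := bc_nvE x; lra.
- by have [e0 e1 e2 e3] := bc_nvE x; rewrite lincomb_mvE e0 e1 e2 e3; apply: R3P => /=; lra.
Qed.

Lemma dot_bc m n : dot m n = 1 - 4 * \sum_a bc (@nv R) a m * bc (@mv R) a n.
Proof.
have [e0 e1 e2 e3] := bc_nvE m; have [f0 f1 f2 f3] := bc_mvE n.
by rewrite sum4 e0 e1 e2 e3 f0 f1 f2 f3 /dot; field.
Qed.

Section DualPair.
Variables (v w : 'I_4 -> R3 R).
Hypothesis vw : dual_pair v w.

Lemma bc_lincomb t : \sum_b t b = 1 -> forall a, bc w a (lincomb v t) = t a.
Proof. by have [h _ _] := vw; exact: h. Qed.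

Lemma bc_sum x : \sum_a bc w a x = 1.
Proof. by have [_ h _] := vw; exact: h. Qed.

Lemma lincomb_bc x : lincomb v (bc w ^~ x) = x.
Proof. by have [_ _ h] := vw; exact: h. Qed.

Lemma bc_inj x y : (forall a, bc w a x = bc w a y) -> x = y.
Proof. by move=> e; rewrite -(lincomb_bc x) -(lincomb_bc y); congr (lincomb v _); exact/funext. Qed.

Lemma bc_sum4 i j k l x : uniq [:: i; j; k; l] ->
  bc w i x + bc w j x + bc w k x + bc w l x = 1.
Proof. by move=> u; rewrite -(bc_sum x) (uniq4_sum _ u). Qed.

Lemma faceE i x : face v i x <-> (forall a, 0 <= bc w a x) /\ bc w i x = 0.
Proof.
split=> [[t [t0 [ti [t1 ->]]]]|[x0 xi]].
  by split=> [a|]; rewrite bc_lincomb.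
by exists (bc w ^~ x); rewrite lincomb_bc bc_sum.
Qed.

Lemma bdryE x :
  simplex_boundary v x <-> (forall a, 0 <= bc w a x) /\ exists a, bc w a x = 0.
Proof.
split=> [[i /faceE[x0 xi]]|[x0 [i xi]]]; first by split=> //; exists i.
by exists i; exact/faceE.
Qed.

Lemma bdry_le1 x a : simplex_boundary v x -> bc w a x <= 1.
Proof.
move=> /bdryE[x0 _]; rewrite -(bc_sum x) (bigD1 a) //= lerDl.
by apply: sumr_ge0.
Qed.

(* [M] is forced to be the coordinate of index [j], because the least of the
   coordinates of index [j], [k] and [l] vanishes away from the face opposite to [i]. *)
Definition ichart j k l (z : R * R) : R3 R :=
  let M := Num.max 0 (Num.max z.1 z.2) in
  lincomb v (fun a => if a == j then M else if a == k then M - z.1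
                      else if a == l then M - z.2 else 1 - (3 * M - z.1 - z.2)).

(** [c = -4] gives the charts of [A], [c = 1] those of [B]. *)
Definition chart (c : R) j k l x : R * R :=
  (c * (bc w j x - bc w k x), c * (bc w j x - bc w l x)).

Lemma bc_ichart i j k l z (M := Num.max 0 (Num.max z.1 z.2)) :
  uniq [:: i; j; k; l] ->
  [/\ bc w i (ichart j k l z) = 1 - (3 * M - z.1 - z.2),
      bc w j (ichart j k l z) = M,
      bc w k (ichart j k l z) = M - z.1 &
      bc w l (ichart j k l z) = M - z.2].
Proof.
move=> u; move: (u); rewrite /= !inE !negb_or => /and4P[/and3P[ij ik il] /andP[jk jl] kl _].
have s : \sum_a (if a == j then M else if a == k then M - z.1
    else if a == l then M - z.2 else 1 - (3 * M - z.1 - z.2)) = 1.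
  rewrite (uniq4_sum _ u) !eqxx (negbTE ij) (negbTE ik) (negbTE il).
  by rewrite (eq_sym k) (negbTE jk) (eq_sym l) (negbTE jl) (eq_sym l) (negbTE kl); ring.
rewrite /ichart !bc_lincomb // !eqxx (negbTE ij) (negbTE ik) (negbTE il).
by rewrite (eq_sym k) (negbTE jk) (eq_sym l) (negbTE jl) (eq_sym l) (negbTE kl).
Qed.

Lemma chartK c i j k l z : uniq [:: i; j; k; l] -> c != 0 ->
  chart c j k l (ichart j k l (c^-1 *: z)) = z.
Proof.
move=> u c0; rewrite /chart; have [_ -> -> ->] := bc_ichart (c^-1 *: z) u.
by case: z => z1 z2; congr pair => /=; rewrite /GRing.scale /=; field.
Qed.

Lemma ichartK c i j k l x : uniq [:: i; j; k; l] -> c != 0 ->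
  simplex_boundary v x -> 0 < bc w i x ->
  ichart j k l (c^-1 *: chart c j k l x) = x.
Proof.
move=> u c0 /bdryE[x0 [a xa]] xi; apply: bc_inj => b.
have s := bc_sum4 x u.
have -> : c^-1 *: chart c j k l x = (bc w j x - bc w k x, bc w j x - bc w l x).
  by rewrite /chart; congr pair => /=; rewrite /GRing.scale /=; field.
set z := (_, _).
(* Some coordinate vanishes, and not the one of index [i]; each of the three remaining cases tells
   which of 0, [z.1], [z.2] is the maximum. *)
have M : Num.max 0 (Num.max z.1 z.2) = bc w j x.
  have := uniq4_mem a u; rewrite !inE /z /= => /or4P[] /eqP ?; subst a.
  - by rewrite xa ltxx in xi.
  - have := (x0 k, x0 l); rewrite xa !sub0r => -[k0 l0].
    by rewrite max_l // ge_max !oppr_le0 k0.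
  - rewrite xa subr0 max_r ?le_max ?x0 // max_l // lerBlDr lerDl; exact: x0.
  - rewrite xa subr0 max_r ?le_max ?x0 ?orbT // max_r // lerBlDr lerDl; exact: x0.
have [ei ej ek el] := bc_ichart z u; rewrite M /= in ei ej ek el.
have := uniq4_mem b u; rewrite !inE => /or4P[] /eqP ->.
- by rewrite ei; lra.
- by rewrite ej.
- by rewrite ek; ring.
- by rewrite el; ring.
Qed.

Lemma bdry_ichart i j k l z : uniq [:: i; j; k; l] ->
  0 <= bc w i (ichart j k l z) -> simplex_boundary v (ichart j k l z).
Proof.
move=> u i0; apply/bdryE; have [ei ej ek el] := bc_ichart z u.
have M0 : 0 <= Num.max 0 (Num.max z.1 z.2) by rewrite le_max lexx.
have M1 : z.1 <= Num.max 0 (Num.max z.1 z.2) by rewrite !le_max lexx orbT.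
have M2 : z.2 <= Num.max 0 (Num.max z.1 z.2) by rewrite !le_max lexx !orbT.
split=> [a|].
  have := uniq4_mem a u; rewrite !inE => /or4P[] /eqP -> //.
  - by rewrite ej.
  - by rewrite ek subr_ge0.
  - by rewrite el subr_ge0.
case: (leP (Num.max z.1 z.2) 0) => [h|h].
  by exists j; rewrite ej; apply/max_idPl.
have e : Num.max 0 (Num.max z.1 z.2) = Num.max z.1 z.2 by apply/max_idPr/ltW.
case: (leP z.1 z.2) => [h'|/ltW h'].
  by exists l; rewrite el e (max_idPr h') subrr.
by exists k; rewrite ek e (max_idPl h') subrr.
Qed.

(** A least pairing is a largest barycentric coordinate, so this becomes [Sreg] or [Treg]. *)
Definition reg i : set (R3 R) :=
  [set x | simplex_boundary v x /\ forall j, j != i -> bc w j x < bc w i x].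

Lemma reg_gt0 i x : reg i x -> 0 < bc w i x.
Proof.
move=> [/bdryE[x0 [a xa]] h].
have [e|ai] := eqVneq a i; last by rewrite -xa h.
have ex : exists j : 'I_4, j != i.
  exists (if i == ord0 then o1 else ord0).
  by case: ifP => [/eqP ->//|/negbT]; rewrite eq_sym.
have [j ji] := ex; by have := le_lt_trans (x0 j) (h _ ji).
Qed.

End DualPair.
End Barycentric.

(** * Lebesgue measure on the plane *)

Section PlaneLebesgue.
Variable R : realType.
Local Notation mu := (@lebesgue_measure R).
Implicit Types (D : set (R * R)).

(** The boxes with rational centres and half-widths [1/(n+1)] are countably many, and those
    contained in [D] cover it. *)
Lemma open_measurable2 D : open D -> measurable (D : set (measurableTypeR R * measurableTypeR R)).
Proof.
move=> oD.
pose box (s : rat * rat * nat) : set (R * R) :=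
  `]ratr s.1.1 - s.2.+1%:R^-1, ratr s.1.1 + s.2.+1%:R^-1[%classic `*`
  `]ratr s.1.2 - s.2.+1%:R^-1, ratr s.1.2 + s.2.+1%:R^-1[%classic.
pose F n := if unpickle n is Some s then
  (if pselect (box s `<=` D) then box s else set0) else set0.
have -> : D = \bigcup_n F n.
  apply/seteqP; split=> [z Dz | z [n _]]; last first.
    by rewrite /F; case: unpickle => [s|] //; case: pselect => // h /h.
  have : nbhs z D by exact: open_nbhs_nbhs.
  move=> /nbhs_ballP[e /= e0 he].
  have [k _ /(_ k (leqnn k)) hk] : \forall k \near \oo, k.+1%:R^-1 < e / 2 :> R.
    by apply: near_infty_natSinv_lt (PosNum _); rewrite divr_gt0.
  rewrite /= in hk.
  have k0 : 0 < k.+1%:R^-1 :> R by rewrite invr_gt0.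
  have boxE p q : box (p, q, k) = `]ratr p - k.+1%:R^-1, ratr p + k.+1%:R^-1[%classic `*`
    `]ratr q - k.+1%:R^-1, ratr q + k.+1%:R^-1[%classic by [].
  move: k.+1%:R^-1 k0 hk boxE => d k0 hk boxE.
  have rat_near (x : R) : exists p : rat, `|x - ratr p| < d.
    have [|p] := @rat_in_itvoo R (x - d) (x + d); first by rewrite ltrD2l gtrN.
    by rewrite in_itv /= => /andP[p1 p2]; exists p; rewrite ltr_distl ltrBlDr p2 -ltrBlDr p1.
  have [p hp] := rat_near z.1; have [q hq] := rat_near z.2.
  exists (pickle (p, q, k)); first exact: I.
  rewrite /F pickleK.
  move: hp hq; rewrite !ltr_distl.
  rewrite boxE; move: (ratr p : R) (ratr q : R) => p' q' /andP[? ?] /andP[? ?].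
  case: pselect => [?|[]].
    by split; rewrite /= in_itv /=; apply/andP; split; lra.
  move=> y [/=]; rewrite !in_itv /= => /andP[? ?] /andP[? ?].
  by apply: he; split; rewrite /ball /= ltr_distl; apply/andP; split; lra.
apply: bigcupT_measurable => n; rewrite /F; case: unpickle => [s|]; last exact: measurable0.
case: pselect => ?; last exact: measurable0.
rewrite /box.
exact: (@measurableX _ _ (measurableTypeR R) (measurableTypeR R) _ _ (measurable_itv _) (measurable_itv _)).
Qed.

Lemma closed_measurable2 D : closed D -> measurable (D : set (measurableTypeR R * measurableTypeR R)).
Proof.
move=> cD; rewrite -(setCK D); apply: measurableC; apply: open_measurable2.
exact: closed_openC.
Qed.

Lemma leb2_rect (a b c d : R) : a <= b -> c <= d ->
  @leb2 R (`[a, b]%classic `*` `[c, d]%classic) = ((b - a) * (d - c))%:E.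
Proof.
move=> ab cd.
have h (x y : R) : x <= y -> lebesgue_measure (`[x, y]%classic : set R) = (y - x)%:E.
  rewrite lebesgue_measure_itv /= lte_fin le_eqVlt => /orP[/eqP->|->].
    by rewrite ltxx subrr.
  by rewrite EFinB.
rewrite EFinM -(h a b) // -(h c d) //.
exact: (@product_measure1E _ _ (measurableTypeR R) (measurableTypeR R) R mu mu _ _
  (measurable_itv _) (measurable_itv _)).
Qed.

(** Tonelli for an indicator: exchanging the coordinates exchanges the two iterated integrals. *)
Lemma leb2_swap D : measurable (D : set (measurableTypeR R * measurableTypeR R)) ->
  @leb2 R ((fun z => (z.2, z.1)) @^-1` D) = @leb2 R D.
Proof.
move=> mD; rewrite /leb2.
have h := indic_fubini_tonelli mu mu mD.
transitivity (\int[mu]_y fubini_G mu (EFin \o \1_D) y)%E.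
  apply: eq_integral => x _.
  apply: etrans (esym (congr1 (@^~ x) (indic_fubini_tonelli_GE mu mD))).
  by congr (mu _); apply/seteqP; split=> y; rewrite /xsection /ysection /= !inE.
rewrite -h; apply: eq_integral => x _.
exact: (congr1 (@^~ x) (indic_fubini_tonelli_FE mu mD)).
Qed.

Lemma lebesgue_measure_addl (c : R) (A : set R) : measurable A ->
  mu (+%R c @^-1` A) = mu A.
Proof.
have mc : measurable_fun setT (+%R c : measurableTypeR R -> measurableTypeR R).
  by apply: measurable_realfun.continuous_measurable_fun => x; exact: (cvgD (cvg_cst c) cvg_id).
move=> mA; rewrite -[LHS]/(pushforward mu (+%R c : _ -> measurableTypeR R) A).
apply/esym/lebesgue_measure_unique => //= _ [[a b]] _ <-.
rewrite /pushforward /= (_ : _ @^-1` _ = `]a - c, b - c]%classic); last first.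
  by apply/seteqP; split=> x; rewrite /= !in_itv /= => /andP[? ?]; apply/andP; split; lra.
rewrite !lebesgue_measure_itv /= !lte_fin ltrD2r -!EFinB.
by case: ifP => // _; congr (_%:E); ring.
Qed.

(** This map is the change of charts that exchanges the base index [j] with [k]. It translates each
    section and reflects the base, and both operations preserve length. *)
Lemma leb2_shear D : measurable (D : set (measurableTypeR R * measurableTypeR R)) ->
  @leb2 R ((fun z => (- z.1, z.2 - z.1)) @^-1` D) = @leb2 R D.
Proof.
move=> mD; rewrite /leb2.
transitivity (\int[mu]_x ((mu \o xsection D) \o -%R) x)%E.
  apply: eq_integral => x _ /=.
  rewrite -(@lebesgue_measure_addl (- x) (xsection D (- x))); last exact: measurable_xsection.
  by congr (mu _); apply/seteqP; split=> y; rewrite /xsection /= !inE /= addrC.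
rewrite [RHS](_ : _ = \int[pushforward mu (-%R : _ -> measurableTypeR R)]_x (mu \o xsection D) x)%E.
  rewrite ge0_integral_pushforward //.
  exact: measurable_fun_xsection.
by apply: eq_measure_integral => A mA _; exact/esym/lebesgue_measureN.
Qed.

End PlaneLebesgue.

(** * Continuity of pairings, coordinates and inverse charts *)

Section Continuity.
Variables (R : realType) (T : topologicalType).

Lemma continuous_fst (U V : topologicalType) : continuous (@fst U V).
Proof. by move=> z; exact: cvg_fst. Qed.

Lemma continuous_snd (U V : topologicalType) : continuous (@snd U V).
Proof. by move=> z; exact: cvg_snd. Qed.

Lemma continuous_pt (f g h : T -> R) : continuous f -> continuous g -> continuous h ->
  continuous (fun x => pt (f x) (g x) (h x)).
Proof. by move=> cf cg ch x; exact: (cvg_pair (cvg_pair (cf x) (cg x)) (ch x)). Qed.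

Lemma continuous_dot (f g : T -> R3 R) : continuous f -> continuous g ->
  continuous (fun x => dot (f x) (g x)).
Proof.
move=> cf cg x.
have h (p : R3 R -> R) (u : T -> R3 R) : continuous p -> continuous u -> {for x, continuous (p \o u)}.
  by move=> cp cu; apply: continuous_comp; [exact: cu | exact: cp].
have c1 : continuous (fun y : R3 R => y.1.1).
  by move=> y; apply: (@continuous_comp _ _ _ fst fst); exact: continuous_fst.
have c2 : continuous (fun y : R3 R => y.1.2).
  by move=> y; apply: (@continuous_comp _ _ _ fst snd); [exact: continuous_fst|exact: continuous_snd].
have c3 : continuous (fun y : R3 R => y.2) by exact: continuous_snd.
exact: (cvgD (cvgD (cvgM (h _ f c1 cf) (h _ g c1 cg)) (cvgM (h _ f c2 cf) (h _ g c2 cg)))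
  (cvgM (h _ f c3 cf) (h _ g c3 cg))).
Qed.

Lemma continuous_bc (w : 'I_4 -> R3 R) a (f : T -> R3 R) : continuous f ->
  continuous (fun x => bc w a (f x)).
Proof.
move=> cf x; apply: cvgM; last exact: cvg_cst.
apply: cvgB; first exact: cvg_cst.
by apply: (continuous_dot _ cf) => y; exact: cvg_cst.
Qed.

Lemma continuous_lincomb (v : 'I_4 -> R3 R) (t : T -> 'I_4 -> R) :
  (forall a, continuous (t ^~ a)) -> continuous (fun x => lincomb v (t x)).
Proof.
move=> ct.
have h (u : 'I_4 -> R) : continuous (fun x => \sum_(j < 4) t x j * u j).
  under eq_fun do rewrite sum4.
  by move=> x; do ![apply: cvgD]; apply: cvgM; try exact: cvg_cst; exact: ct.
by apply: continuous_pt; exact: h.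
Qed.

Lemma continuous_ichart (v : 'I_4 -> R3 R) j k l (f : T -> R * R) :
  continuous f -> continuous (fun x => ichart v j k l (f x)).
Proof.
move=> cf.
have c1 : continuous (fun x => (f x).1).
  by move=> x; apply: (@continuous_comp _ _ _ f fst); [exact: cf|exact: continuous_fst].
have c2 : continuous (fun x => (f x).2).
  by move=> x; apply: (@continuous_comp _ _ _ f snd); [exact: cf|exact: continuous_snd].
have cM : continuous (fun x => Num.max 0 (Num.max (f x).1 (f x).2)).
  move=> x; exact: (@continuous_max R T (cst 0) (fun x => Num.max (f x).1 (f x).2) x
    (cvg_cst _) (@continuous_max R T (fun x => (f x).1) (fun x => (f x).2) x (c1 x) (c2 x))).
pose t x a := let M := Num.max 0 (Num.max (f x).1 (f x).2) in
  if a == j then M else if a == k then M - (f x).1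
  else if a == l then M - (f x).2 else 1 - (3 * M - (f x).1 - (f x).2).
apply: (@continuous_lincomb v t) => a x; rewrite /t /=.
case: (a == j); first exact: cM.
case: (a == k); first by apply: cvgB; [exact: cM|exact: c1].
case: (a == l); first by apply: cvgB; [exact: cM|exact: c2].
apply: cvgB; first exact: cvg_cst.
apply: cvgB; last exact: c2.
apply: cvgB; last exact: c1.
by apply: cvgM; [exact: cvg_cst|exact: cM].
Qed.

Lemma closed_le_fun (f g : T -> R) : continuous f -> continuous g ->
  closed [set x | f x <= g x].
Proof.
move=> cf cg; rewrite (_ : [set _ | _] = (fun x => f x - g x) @^-1` [set y | y <= 0]).
  apply: closed_comp; last exact: closed_le.
  by move=> x _; apply: cvgB; [exact: cf|exact: cg].
by apply/seteqP; split=> x /=; rewrite subr_le0.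
Qed.

Lemma open_lt_fun (f g : T -> R) : continuous f -> continuous g ->
  open [set x | f x < g x].
Proof.
move=> cf cg; rewrite (_ : [set _ | _] = ~` [set x | g x <= f x]).
  by apply: closed_openC; exact: closed_le_fun.
by apply/seteqP; split=> x /=; rewrite ltNge => /negP.
Qed.

End Continuity.

(** * Chart images of closed sets and independence of the chart *)

Section BoundaryMeasure.
Variables (R : realType) (v w : 'I_4 -> R3 R) (c : R).
Hypotheses (vw : dual_pair v w) (c0 : c != 0).
Implicit Types (i j k l a : 'I_4) (S : set (R3 R)).

Lemma closed_bdry : closed (simplex_boundary v).
Proof.
have cb a : continuous (bc w a) by apply: continuous_bc => x; exact: cvg_id.
have cc : continuous (fun _ : R3 R => 0 : R) by move=> x; exact: cvg_cst.
have ge a : closed [set x | 0 <= bc w a x] by exact: closed_le_fun.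
have le a : closed [set x | bc w a x <= 0] by exact: closed_le_fun.
have -> : simplex_boundary v = \bigcap_a [set x | 0 <= bc w a x] `&`
    ([set x | bc w o0 x <= 0] `|` [set x | bc w o1 x <= 0] `|`
     [set x | bc w o2 x <= 0] `|` [set x | bc w o3 x <= 0]).
  apply/seteqP; split=> x.
    move=> /(bdryE vw)[x0 [a xa]]; split=> [b _|]; first exact: x0.
    move: xa; case: (ord4P a) => [[[] | ] | ] -> /= ->.
    - by left; left; left.
    - by left; left; right.
    - by left; right.
    - by right.
  move=> [x0 h]; apply/(bdryE vw); split=> [a|]; first exact: x0.
  have z a : bc w a x <= 0 -> exists a, bc w a x = 0.
    by move=> xa; exists a; apply/eqP; rewrite eq_le xa; exact: x0.
  by case: h => [[[] | ] | ] /z.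
by apply: closedI; [exact: closed_bigI | do ![apply: closedU]].
Qed.

(** Rewriting the image as a preimage under the continuous inverse chart reduces its measurability
    to closed and open sets. *)
Lemma image_chartE S i j k l (G := fun z => ichart v j k l (c^-1 *: z)) :
  uniq [:: i; j; k; l] -> S `<=` simplex_boundary v ->
  chart w c j k l @` (S `&` reg v w i) =
  G @^-1` S `&` [set z | forall a, a != i -> bc w a (G z) < bc w i (G z)].
Proof.
move=> u Sb; apply/seteqP; split=> [_ [x [Sx rx] <-] | z [Sz rz]].
  have xi := reg_gt0 vw rx.
  rewrite /G /preimage /= (ichartK vw u c0 rx.1 xi); split=> //.
  by have [] := rx.
exists (G z); last exact: (chartK vw z u c0).
by split=> //; split=> //; exact: Sb.
Qed.

Lemma measurable_image_chart S i j k l :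
  uniq [:: i; j; k; l] -> S `<=` simplex_boundary v -> closed S ->
  measurable (chart w c j k l @` (S `&` reg v w i) :
                set (measurableTypeR R * measurableTypeR R)).
Proof.
move=> u Sb cS; rewrite image_chartE //.
set G := fun z => ichart v j k l (c^-1 *: z).
have cG : continuous G.
  by apply: continuous_ichart => z; exact: (@scaler_continuous _ _ (c^-1) z).
apply: (@measurableI _ (measurableTypeR R * measurableTypeR R)%type).
  by apply: closed_measurable2; apply: closed_comp => // z _; exact: cG.
have cb a : continuous (fun z => bc w a (G z)) by exact: continuous_bc.
have -> : [set z | forall a, a != i -> bc w a (G z) < bc w i (G z)] =
   [set z | bc w j (G z) < bc w i (G z)] `&` [set z | bc w k (G z) < bc w i (G z)]
   `&` [set z | bc w l (G z) < bc w i (G z)].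
  move: (u); rewrite /= !inE !negb_or => /and4P[/and3P[ij ik il] _ _ _].
  apply/seteqP; split=> z /=.
    by move=> h; split; [split|]; apply: h; rewrite eq_sym.
  move=> [[hj hk] hl] a ai; have := uniq4_mem a u.
  by rewrite !inE (negbTE ai) /= => /or3P[] /eqP ->.
by apply: open_measurable2; apply: openI; [apply: openI|]; exact: open_lt_fun.
Qed.

Lemma leb2_chart_swap S i j k l :
  uniq [:: i; j; k; l] -> S `<=` simplex_boundary v -> closed S ->
  @leb2 R (chart w c j l k @` (S `&` reg v w i)) = leb2 (chart w c j k l @` (S `&` reg v w i)).
Proof.
move=> u Sb cS; rewrite -(leb2_swap (measurable_image_chart u Sb cS)); congr leb2.
apply/seteqP; split=> [_ [x Sx <-]|[z1 z2] [x Sx [<- <-]]]; by exists x.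
Qed.

Lemma leb2_chart_shear S i j k l :
  uniq [:: i; j; k; l] -> S `<=` simplex_boundary v -> closed S ->
  @leb2 R (chart w c k j l @` (S `&` reg v w i)) = leb2 (chart w c j k l @` (S `&` reg v w i)).
Proof.
move=> u Sb cS; rewrite -(leb2_shear (measurable_image_chart u Sb cS)); congr leb2.
apply/seteqP; split=> [_ [x Sx <-]|[z1 z2] [x Sx [e1 e2]]]; exists x => //.
  by rewrite /chart /=; congr pair; ring.
by rewrite /chart; congr pair; lra.
Qed.

(** The swap and the shear act as two transpositions, which generate all six orderings of the
    indices other than [i]. Hence the choice [jsel] made in [muA] and [nuB] has no influence. *)
Lemma leb2_chart S i j k l j' k' l' :
  uniq [:: i; j; k; l] -> uniq [:: i; j'; k'; l'] ->
  S `<=` simplex_boundary v -> closed S ->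
  @leb2 R (chart w c j' k' l' @` (S `&` reg v w i)) = leb2 (chart w c j k l @` (S `&` reg v w i)).
Proof.
move=> u u' Sb cS.
have sw (p q r : 'I_4) : uniq [:: i; p; q; r] -> @leb2 R (chart w c p r q @` (S `&` reg v w i)) =
    leb2 (chart w c p q r @` (S `&` reg v w i)) by move=> h; exact: leb2_chart_swap.
have sh (p q r : 'I_4) : uniq [:: i; p; q; r] -> @leb2 R (chart w c q p r @` (S `&` reg v w i)) =
    leb2 (chart w c p q r @` (S `&` reg v w i)) by move=> h; exact: leb2_chart_shear.
have us (p q r : 'I_4) : uniq [:: i; p; q; r] -> uniq [:: i; p; r; q].
  by rewrite /= !inE !negb_or (eq_sym r q) => /and4P[/and3P[-> -> ->] /andP[-> ->] -> _].
have uh (p q r : 'I_4) : uniq [:: i; p; q; r] -> uniq [:: i; q; p; r].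
  by rewrite /= !inE !negb_or (eq_sym q p) => /and4P[/and3P[-> -> ->] /andP[-> ->] -> _].
have mem a : a != i -> [|| a == j, a == k | a == l].
  by move=> ai; have := uniq4_mem a u; rewrite !inE (negbTE ai).
move: (u'); rewrite /= !inE !negb_or => /and4P[/and3P[ij ik il] /andP[jk jl] kl _].
rewrite eq_sym in ij; rewrite eq_sym in ik; rewrite eq_sym in il.
have := mem _ ij; have := mem _ ik; have := mem _ il.
move=> /or3P[]/eqP el /or3P[]/eqP ek /or3P[]/eqP ej; subst j' k' l';
  try (by exfalso; rewrite eqxx in jk); try (by exfalso; rewrite eqxx in jl);
  try (by exfalso; rewrite eqxx in kl).
- rewrite (sh _ _ _ (us _ _ _ (uh _ _ _ u))) (sw _ _ _ (uh _ _ _ u)); exact: sh.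
- rewrite (sw _ _ _ (uh _ _ _ u)); exact: sh.
- rewrite (sh _ _ _ (us _ _ _ u)); exact: sw.
- exact: sw.
- exact: sh.
- reflexivity.
Qed.

End BoundaryMeasure.

(** * Mass on a simplex boundary: monotonicity, bounds, symmetry *)

Section TotalMass.
Variables (R : realType) (v w : 'I_4 -> R3 R) (c : R).
Hypotheses (vw : dual_pair v w) (c0 : c != 0).
Implicit Types (i j k l a : 'I_4) (S : set (R3 R)).

Lemma jsel_neq i : i != jsel i.
Proof.
rewrite /jsel; case: ifPn => [/eqP ->|//].
by rewrite -val_eqE /= inordK.
Qed.

Definition chart_image S i : set (R * R) :=
  chart w c (jsel i) (kidx i (jsel i)) (lidx i (jsel i)) @` (S `&` reg v w i).

Definition bdry_mass S : \bar R := (\sum_(i < 4) leb2 (chart_image S i))%E.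

Lemma measurable_chart_image S i : S `<=` simplex_boundary v -> closed S ->
  measurable (chart_image S i : set (measurableTypeR R * measurableTypeR R)).
Proof. by move=> Sb cS; exact: (measurable_image_chart vw c0 (uniq4_kl (jsel_neq i))). Qed.

Lemma le_leb2 (D E : set (R * R)) :
  measurable (D : set (measurableTypeR R * measurableTypeR R)) ->
  measurable (E : set (measurableTypeR R * measurableTypeR R)) ->
  D `<=` E -> (@leb2 R D <= leb2 E)%E.
Proof. by move=> mD mE DE; rewrite /leb2; apply: le_measure => //; rewrite inE. Qed.

Lemma le_bdry_mass S S' : S' `<=` simplex_boundary v -> closed S -> closed S' ->
  S `<=` S' -> (bdry_mass S <= bdry_mass S')%E.
Proof.
move=> Sb cS cS' SS'; apply: lee_sum => i _; apply: le_leb2.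
- by apply: measurable_chart_image => //; exact: subset_trans Sb.
- exact: measurable_chart_image.
- by move=> _ [x [Sx rx] <-]; exists x => //; split=> //; exact: SS'.
Qed.

Lemma bdry_mass_ge0 S : (0 <= bdry_mass S)%E.
Proof. by apply: sume_ge0 => i _; rewrite /leb2. Qed.

(** Each chart is injective where its coordinate of index [i] is positive, so disjoint sets have
    disjoint images. *)
Lemma bdry_massD S1 S2 S : S `<=` simplex_boundary v -> closed S1 -> closed S2 -> closed S ->
  S1 `<=` S -> S2 `<=` S -> S1 `&` S2 = set0 ->
  (bdry_mass S1 + bdry_mass S2 <= bdry_mass S)%E.
Proof.
move=> Sb c1 c2 cS S1S S2S S12; rewrite /bdry_mass -big_split /=.
have S1b := subset_trans S1S Sb; have S2b := subset_trans S2S Sb.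
apply: lee_sum => i _.
have m1 := @measurable_chart_image S1 i S1b c1.
have m2 := @measurable_chart_image S2 i S2b c2.
have h := @measureU _ _ _ (@product_measure1 _ _ (measurableTypeR R) (measurableTypeR R) R
  (@lebesgue_measure R) (@lebesgue_measure R)) _ _ m1 m2.
apply: le_trans (le_leb2 _ (@measurable_chart_image S i Sb cS) _); last 2 first.
- exact: measurableU m1 m2.
- by move=> _ [[x [Sx rx] <-] | [x [Sx rx] <-]]; exists x => //; split=> //; [exact: S1S|exact: S2S].
rewrite /leb2 h //; apply/seteqP; split=> // z [[x [Sx rx] <-] [y [Sy ry] e]].
have u := uniq4_kl (jsel_neq i).
have : (S1 `&` S2) x.
  split=> //; rewrite -(ichartK vw u c0 (S1b _ Sx) (reg_gt0 vw rx)) -e.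
  by rewrite (ichartK vw u c0 (S2b _ Sy) (reg_gt0 vw ry)).
by rewrite S12.
Qed.

Lemma le_rect_bdry_mass S i j k l x1 x2 y1 y2 : uniq [:: i; j; k; l] ->
  S `<=` simplex_boundary v -> closed S -> x1 <= x2 -> y1 <= y2 ->
  `[x1, x2]%classic `*` `[y1, y2]%classic `<=` chart w c j k l @` (S `&` reg v w i) ->
  (((x2 - x1) * (y2 - y1))%:E <= bdry_mass S)%E.
Proof.
move=> u Sb cS x12 y12 h; rewrite -leb2_rect // /bdry_mass (bigD1 i) //=.
apply: le_trans (leeDl _ _); last by apply: sume_ge0 => a _; rewrite /leb2.
rewrite /chart_image (leb2_chart vw c0 u (uniq4_kl (jsel_neq i)) Sb cS).
apply: le_leb2 => //; last exact: measurable_image_chart.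
exact: (@measurableX _ _ (measurableTypeR R) (measurableTypeR R) _ _ (measurable_itv _) (measurable_itv _)).
Qed.

(** Each of the four charts sends each of the four boxes around the centres [z b] into a square of
    side [4 * |c| * e], whence sixteen squares. Four centres are allowed because the application
    takes one per face of [A]. *)
Lemma bdry_mass_box S (z : 'I_4 -> 'I_4 -> R) (e : R) : 0 <= e ->
  S `<=` simplex_boundary v -> closed S ->
  (forall x, S x -> exists b, forall a, `|bc w a x - z b a| <= e) ->
  (bdry_mass S <= (16 * (4 * `|c| * e) ^+ 2)%:E)%E.
Proof.
move=> e0 Sb cS h.
pose d := 2 * `|c| * e.
have d0 : 0 <= d by rewrite /d !mulr_ge0.
pose itv (x : R) : set R := `[x - d, x + d]%classic.
pose B i b := itv (c * (z b (jsel i) - z b (kidx i (jsel i)))) `*`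
              itv (c * (z b (jsel i) - z b (lidx i (jsel i)))).
have mB i b : measurable (B i b : set (measurableTypeR R * measurableTypeR R)).
  exact: (@measurableX _ _ (measurableTypeR R) (measurableTypeR R) _ _ (measurable_itv _) (measurable_itv _)).
have lB i b : @leb2 R (B i b) = ((2 * d) ^+ 2)%:E.
  by rewrite leb2_rect; [congr (_%:E); ring | lra | lra].
have sub i : chart_image S i `<=` B i o0 `|` B i o1 `|` B i o2 `|` B i o3.
  move=> _ [x [Sx rx] <-].
  have [b hb] := h x Sx.
  have : B i b (chart w c (jsel i) (kidx i (jsel i)) (lidx i (jsel i)) x).
    have near a a' : itv (c * (z b a - z b a')) (c * (bc w a x - bc w a' x)).
      rewrite /itv /= in_itv /= -ler_distl -mulrBr normrM /d.
      rewrite (mulrC 2) -mulrA ler_wpM2l //.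
      apply: le_trans (_ : `|(bc w a x - z b a) - (bc w a' x - z b a')| <= _).
        by rewrite le_eqVlt; apply/orP; left; apply/eqP; congr (`|_|); ring.
      by apply: le_trans (ler_normB _ _) _; have := hb a; have := hb a'; lra.
    by split; exact: near.
  case: (ord4P b) => [[[] | ] | ] -> ?.
  - by left; left; left.
  - by left; left; right.
  - by left; right.
  - by right.
have le i : (leb2 (chart_image S i) <= (4 * (2 * d) ^+ 2)%:E)%E.
  pose P := @product_measure1 _ _ (measurableTypeR R) (measurableTypeR R) R
    (@lebesgue_measure R) (@lebesgue_measure R).
  have mU (D E : set (measurableTypeR R * measurableTypeR R)) : measurable D -> measurable E ->
      (P (D `|` E) <= P D + P E)%E by exact: measureU2.
  have mUU := @measurableU _ (measurableTypeR R * measurableTypeR R)%type.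
  apply: le_trans (le_leb2 _ _ (sub i)) _.
  - exact: measurable_chart_image.
  - exact: mUU _ _ (mUU _ _ (mUU _ _ (mB _ _) (mB _ _)) (mB _ _)) (mB _ _).
  apply: le_trans (mU _ _ (mUU _ _ (mUU _ _ (mB _ _) (mB _ _)) (mB _ _)) (mB _ _)) _.
  rewrite (_ : 4 * (2 * d) ^+ 2 = (2 * d) ^+ 2 + (2 * d) ^+ 2 + (2 * d) ^+ 2 + (2 * d) ^+ 2); last by ring.
  rewrite !EFinD; apply: leeD; last by rewrite -(lB i o3).
  apply: le_trans (mU _ _ (mUU _ _ (mB _ _) (mB _ _)) (mB _ _)) _.
  apply: leeD; last by rewrite -(lB i o2).
  apply: le_trans (mU _ _ (mB _ _) (mB _ _)) _.
  by apply: leeD; [rewrite -(lB i o0) | rewrite -(lB i o1)].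
apply: le_trans (lee_sum _ (fun i _ => le i)) _.
rewrite sumEFin sumr_const card_ord lee_fin /d -mulr_natl.
by rewrite le_eqVlt; apply/orP; left; apply/eqP; ring.
Qed.

Lemma bdry_mass_lty S : S `<=` simplex_boundary v -> closed S -> (bdry_mass S < +oo)%E.
Proof.
move=> Sb cS; apply: le_lt_trans (ltry (16 * (4 * `|c| * 1) ^+ 2)).
apply: (@bdry_mass_box _ (fun _ _ => 0)) => // x Sx; exists o0 => a.
rewrite subr0 ger0_norm; first exact: (bdry_le1 vw _ (Sb _ Sx)).
by have /(bdryE vw)[] := Sb _ Sx.
Qed.

Definition permute (s : {perm 'I_4}) x : R3 R := lincomb v (fun a => bc w (s a) x).

Lemma bc_permute s x a : bc w a (permute s x) = bc w (s a) x.
Proof.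
apply: (bc_lincomb vw).
by rewrite -(bc_sum vw x) [RHS](reindex_inj (@perm_inj _ s)).
Qed.

Lemma permute_bdry s x : simplex_boundary v (permute s x) <-> simplex_boundary v x.
Proof.
rewrite !(bdryE vw); split=> -[x0 [a xa]]; split=> [b|].
- by have := x0 (s^-1 b)%g; rewrite bc_permute permKV.
- by exists (s a); rewrite -bc_permute.
- by rewrite bc_permute.
- by exists (s^-1 a)%g; rewrite bc_permute permKV.
Qed.

Lemma permute_reg s x i : reg v w i (permute s x) <-> reg v w (s i) x.
Proof.
rewrite /reg /= permute_bdry; split=> -[xb h]; split=> // j ji.
  have := h (s^-1 j)%g; rewrite !bc_permute permKV; apply.
  by apply: contraNneq ji => <-; rewrite permKV.
by rewrite !bc_permute; apply: h; rewrite (inj_eq perm_inj).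
Qed.

(** The chart at [i] of the permuted set has the same image as a chart at [s i] of the original set;
    [leb2_chart] absorbs the change of auxiliary indices. *)
Lemma bdry_mass_permute s S : S `<=` simplex_boundary v -> closed S ->
  bdry_mass (permute s @` S) = bdry_mass S.
Proof.
move=> Sb cS; rewrite /bdry_mass [RHS](reindex_inj (@perm_inj _ s)) /=.
apply: eq_bigr => i _.
have u := uniq4_kl (jsel_neq i).
rewrite [chart_image (permute s @` S) i]/chart_image.
move: (kidx i (jsel i)) (lidx i (jsel i)) u; move: (jsel i) => j k l u.
have us : uniq [:: s i; s j; s k; s l].
  rewrite -[X in uniq X]/(map s [:: i; j; k; l]) map_inj_uniq //; exact: perm_inj.
rewrite /chart_image (leb2_chart vw c0 us (uniq4_kl (jsel_neq (s i))) Sb cS).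
congr leb2; apply/seteqP; split=> [_ [_ [[x Sx <-] rx] <-]|_ [x [Sx rx] <-]].
  exists x; first by split=> //; exact/permute_reg.
  by rewrite /chart !bc_permute.
exists (permute s x); last by rewrite /chart !bc_permute.
by split; [exists x|exact/permute_reg].
Qed.

End TotalMass.

(** * The two given measures as boundary masses *)

Section MuNu.
Variable R : realType.

Lemma muAE : @muA R = bdry_mass (@mv R) (@nv R) (-4).
Proof.
apply/funext => S; apply: eq_bigr => i _; congr leb2.
have e x a b : dot x (nv R a) - dot x (nv R b) = -4 * (bc (@nv R) a x - bc (@nv R) b x).
  by rewrite /bc !(dotC x); field.
have r x : (S `&` @Sreg R i) x <-> (S `&` reg (@mv R) (@nv R) i) x.
  split=> -[Sx [xb h]]; split=> //; split=> // j ji; have := h j ji; rewrite /bc (dotC x) (dotC x); lra.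
by apply/seteqP; split=> _ [x /r Sx <-]; exists x => //; rewrite /chart /pchart !e.
Qed.

Lemma nuBE : @nuB R = bdry_mass (@nv R) (@mv R) 1.
Proof.
apply/funext => S; apply: eq_bigr => i _; congr leb2.
have e x a b : (dot (mv R a) x - dot (mv R b) x) / 4 = 1 * (bc (@mv R) b x - bc (@mv R) a x).
  by rewrite /bc; field.
have r x : (S `&` @Treg R i) x <-> (S `&` reg (@nv R) (@mv R) i) x.
  by split=> -[Sx [xb h]]; split=> //; split=> // j ji; have := h j ji; rewrite /bc; lra.
by apply/seteqP; split=> _ [x /r Sx <-]; exists x => //; rewrite /chart /qchart !e.
Qed.

End MuNu.

(** * Conjugation over a bounded set *)

Section Conjugation.
Variable R : realType.
Implicit Types (x y m n : R3 R) (K : set (R3 R)) (f : R3 R -> R).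

Definition ct K f x : R := sup [set dot y x - f y | y in K].

Lemma ctAE phi : @ctA R phi = ct (@Aset R) phi.
Proof. by []. Qed.

Lemma ctBE psi : @ctB R psi = ct (@Bset R) psi.
Proof.
apply/funext => m; congr sup; apply/seteqP.
by split=> _ [n Bn <-]; exists n => //; rewrite dotC.
Qed.

Lemma norm_dot_le x y : `|dot x y| <= 3 * `|x| * `|y|.
Proof.
have n1 (z : R3 R) : `|z.1.1| <= `|z| by rewrite prod_normE /= prod_normE /= !le_max lexx.
have n2 (z : R3 R) : `|z.1.2| <= `|z| by rewrite prod_normE /= prod_normE /= !le_max lexx orbT.
have n3 (z : R3 R) : `|z.2| <= `|z| by rewrite prod_normE /= !le_max lexx orbT.
have h (a b : R) : `|a| <= `|x| -> `|b| <= `|y| -> `|a * b| <= `|x| * `|y|.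
  by move=> ? ?; rewrite normrM ler_pM.
rewrite /dot; apply: le_trans (ler_normD _ _) _.
have := ler_normD (x.1.1 * y.1.1) (x.1.2 * y.1.2).
have := h _ _ (n1 x) (n1 y); have := h _ _ (n2 x) (n2 y); have := h _ _ (n3 x) (n3 y).
by rewrite -mulrA; lra.
Qed.

Lemma dotBr x y z : dot x (y - z) = dot x y - dot x z.
Proof. by rewrite /dot /=; ring. Qed.

Lemma lipschitz_continuous f (C : R) :
  (forall x y, f x - f y <= C * `|x - y|) -> continuous f.
Proof.
move=> h x.
have C0 : 0 < `|C| + 1 by rewrite ltr_pwDr.
apply/cvgrPdist_lt => e e0.
have d0 : 0 < e / (`|C| + 1) by rewrite divr_gt0.
have nx : \forall y \near x, `|x - y| < e / (`|C| + 1).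
  by have /cvgrPdist_lt/(_ _ d0) := @cvg_id _ (nbhs x).
near=> y.
have d : `|x - y| < e / (`|C| + 1) by near: y.
have hC (a b : R3 R) : `|a - b| < e / (`|C| + 1) -> f a - f b < e.
  move=> ab; apply: le_lt_trans (h a b) _.
  apply: (@le_lt_trans _ _ ((`|C| + 1) * `|a - b|)).
    by rewrite ler_wpM2r // (le_trans (ler_norm _)) // lerDl.
  by rewrite mulrC -ltr_pdivlMr.
have := hC x y d; have := hC y x; rewrite distrC => /(_ d).
by rewrite ltr_norml; lra.
Unshelve. all: by end_near. Qed.

Section Ct.
Variables (K : set (R3 R)) (f : R3 R -> R) (M N : R).
Hypotheses (K0 : K !=set0) (KM : forall y, K y -> `|y| <= M) (fN : forall y, K y -> N <= f y).

Lemma ct_has_sup x : has_sup [set dot y x - f y | y in K].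
Proof.
split; first by have [y Ky] := K0; exists (dot y x - f y), y.
exists (3 * M * `|x| - N) => _ [y Ky <-].
have := norm_dot_le y x; have := ler_norm (dot y x); have := fN Ky.
have : 3 * `|y| * `|x| <= 3 * M * `|x|.
  by rewrite -!mulrA ler_wpM2l // ler_wpM2r // KM.
by lra.
Qed.

Lemma le_ct x y : K y -> dot y x - f y <= ct K f x.
Proof. by move=> Ky; apply: sup_ubound; [case: (ct_has_sup x) | exists y]. Qed.

Lemma ct_le x z : (forall y, K y -> dot y x - f y <= z) -> ct K f x <= z.
Proof.
move=> h; apply: sup_le_ub; first by case: (ct_has_sup x).
by move=> _ [y Ky <-]; exact: h.
Qed.

(** A supremum of affine functions with slopes in a bounded set is Lipschitz; the factor 3 comes
    from pairing in the sup norm. *)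
Lemma continuous_ct : continuous (ct K f).
Proof.
apply: (@lipschitz_continuous _ (3 * M)) => x y.
rewrite lerBlDl; apply: ct_le => m Km.
have := le_ct y Km; have := norm_dot_le m (x - y); have := ler_norm (dot m (x - y)).
rewrite dotBr; have : 3 * `|m| * `|x - y| <= 3 * M * `|x - y|.
  by rewrite -!mulrA ler_wpM2l // ler_wpM2r // KM.
by lra.
Qed.

End Ct.
End Conjugation.

(** * Compactness of the boundaries and attained conjugates *)

Section CompactBoundary.
Variables (R : realType) (v w : 'I_4 -> R3 R).
Hypothesis vw : dual_pair v w.

Lemma bdry_bounded : exists M, forall x, simplex_boundary v x -> `|x| <= M.
Proof.
exists (\sum_a `|v a|) => x xb.
have h (p : R3 R -> R) : (forall z, `|p z| <= `|z|) ->
    `|\sum_a bc w a x * p (v a)| <= \sum_a `|v a|.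
  move=> hp; apply: le_trans (ler_norm_sum _ _ _) _; apply: ler_sum => a _.
  rewrite normrM -[leRHS]mul1r ler_pM //.
  rewrite ger0_norm ?(bdry_le1 vw) //.
  by have /(bdryE vw)[] := xb.
rewrite -(lincomb_bc vw x) prod_normE /= prod_normE /= !ge_max; apply/andP; split; [apply/andP; split|].
- by apply: (h (fun z => z.1.1)) => z; rewrite prod_normE /= prod_normE /= !le_max lexx.
- by apply: (h (fun z => z.1.2)) => z; rewrite prod_normE /= prod_normE /= !le_max lexx orbT.
- by apply: (h (fun z => z.2)) => z; rewrite prod_normE /= !le_max lexx orbT.
Qed.

Lemma compact_bdry : compact (simplex_boundary v).
Proof.
have [M hM] := bdry_bounded.
apply: (@subclosed_compact _ _ ((`[-M, M] `*` `[-M, M]) `*` `[-M, M])).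
- exact: closed_bdry vw.
- by do ![apply: compact_setX]; exact: segment_compact.
- move=> x /hM; rewrite prod_normE /= prod_normE /= !ge_max => /andP[/andP[h1 h2] h3].
  by do ![split]; rewrite /= in_itv /= -ler_norml.
Qed.

Lemma bdry_nonempty : simplex_boundary v !=set0.
Proof.
exists (ichart v o1 o2 o3 (0, 0)); apply: (bdry_ichart vw (i := o0)) => //.
have [-> _ _ _] := bc_ichart vw (0, 0) (isT : uniq [:: o0; o1; o2; o3]).
by rewrite /= !maxxx; lra.
Qed.

End CompactBoundary.

Section Duality.
Variable R : realType.
Local Notation A := (@Aset R).
Local Notation B := (@Bset R).

(** In use, [psi] is the double conjugate of the given potential and is continuous on the whole
    space. The given potential is controlled on [B] only; it appears below as [psi0]. *)
Definition conjugate_pair (phi psi : R3 R -> R) :=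
  [/\ continuous phi, continuous psi,
      forall m n, A m -> B n -> dot m n <= phi m + psi n,
      forall m, A m -> exists2 n, B n & phi m + psi n = dot m n &
      forall n, B n -> exists2 m, A m & phi m + psi n = dot m n].

Lemma conjugate_pair_ct (psi : R3 R -> R) : boundedOn B psi -> c_convexB psi ->
  conjugate_pair (ctB psi) (ctA (ctB psi)).
Proof.
move=> [N psiN] psic; rewrite ctAE ctBE; set phi := ct B psi; set chi := ct A phi.
have chiE n : B n -> chi n = psi n by move=> Bn; rewrite -psic // ctBE.
have [MA hA] := bdry_bounded (dual_mn R); have [MB hB] := bdry_bounded (dual_nm R).
have A0 := bdry_nonempty (dual_mn R); have B0 := bdry_nonempty (dual_nm R).
have psiN' n : B n -> - N <= psi n by move=> /psiN; rewrite ler_norml => /andP[].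
have [n0 Bn0] := B0.
(* A single competitor [n0] in the supremum gives a lower bound uniform on [A]. *)
have phiN m : A m -> - (3 * MA * `|n0|) - psi n0 <= phi m.
  move=> Am; have := le_ct B0 hB psiN' m Bn0; rewrite dotC.
  have := norm_dot_le m n0; rewrite ler_norml => /andP[h _].
  have : 3 * `|m| * `|n0| <= 3 * MA * `|n0|.
    by rewrite -!mulrA ler_wpM2l // ler_wpM2r // hA.
  by rewrite -/phi; lra.
have cphi : continuous phi := continuous_ct B0 hB psiN'.
have cchi : continuous chi := continuous_ct A0 hA phiN.
have cdot (K : set (R3 R)) (f : R3 R -> R) x : continuous f ->
    {within K, continuous (fun y => dot y x - f y)}.
  move=> cf; apply: continuous_subspaceT => y; apply: cvgB; last exact: cf.
  by apply: continuous_dot => z; [exact: cvg_id | exact: cvg_cst].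
split=> // [m n Am Bn | m Am | n Bn].
- by have := le_ct A0 hA phiN n Am; rewrite -/chi; lra.
- have [n] := compact_EVT_max B0 (compact_bdry (dual_nm R)) (cdot _ _ m cchi).
  rewrite inE => Bn hn; exists n => //.
  have : phi m <= dot n m - chi n.
    apply: (ct_le B0 hB psiN') => y By; rewrite -chiE //.
    by apply: hn; rewrite inE.
  by have := le_ct A0 hA phiN n Am; rewrite -/chi (dotC n); lra.
- have [m] := compact_EVT_max A0 (compact_bdry (dual_mn R)) (cdot _ _ n cphi).
  rewrite inE => Am hm; exists m => //.
  have : chi n <= dot m n - phi m.
    by apply: (ct_le A0 hA phiN) => y Ay; apply: hm; rewrite inE.
  by have := le_ct A0 hA phiN n Am; rewrite -/chi; lra.
Qed.

End Duality.

(** * Differentials and affine minorants *)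

Section Gradient.
Variable R : realType.
Implicit Types (f : R * R -> R) (x v : R * R).

Lemma diff_ge f x v (c e : R) : differentiable f x -> 0 < e ->
  (forall h, 0 < h < e -> c * h <= f (x + h *: v) - f x) -> c <= 'd f x v.
Proof.
move=> df e0 hf; rewrite -deriveE //.
have dv : derivable f x v by exact: diff_derivable.
have cr := cvg_dnbhs_at_right dv.
apply: (cvgr_to_ge cr); near=> h.
have h0 : 0 < h by near: h; exact: nbhs_right_gt.
have he : h < e by near: h; exact: nbhs_right_lt.
rewrite /= [_^-1 *: _]mulrC ler_pdivlMr // (addrC (h *: v)); apply: hf.
by rewrite h0.
Unshelve. all: by end_near. Qed.

Lemma norm_scale_lt (x : R) (e : R) : 0 < e -> exists2 d, 0 < d & forall h, 0 < h < d -> `|h * x| < e.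
Proof.
move=> e0; have x0 : 0 < `|x| + 1 by rewrite ltr_pwDr.
exists (e / (`|x| + 1)); first by rewrite divr_gt0.
move=> h /andP[h0]; rewrite ltr_pdivlMr // normrM (gtr0_norm h0); apply: le_lt_trans.
by rewrite ler_pM2l // lerDl.
Qed.

(** The differential dominates the linear form in the directions [v] and [-v], hence equals it. *)
Lemma diff_eq_minorant f x (a b e : R) : differentiable f x -> 0 < e ->
  (forall y, `|y.1 - x.1| < e -> `|y.2 - x.2| < e ->
     a * (y.1 - x.1) + b * (y.2 - x.2) <= f y - f x) ->
  forall v, 'd f x v = a * v.1 + b * v.2.
Proof.
move=> df e0 hf.
have ge v : a * v.1 + b * v.2 <= 'd f x v.
  have [d1 d10 h1] := norm_scale_lt v.1 e0; have [d2 d20 h2] := norm_scale_lt v.2 e0.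
  apply: (@diff_ge _ _ _ _ (Num.min d1 d2) df); first by rewrite lt_min d10.
  move=> h; rewrite lt_min => /and3P[h0 hd1 hd2].
  have e1 : (x + h *: v).1 - x.1 = h * v.1 by rewrite /= addrC addKr.
  have e2 : (x + h *: v).2 - x.2 = h * v.2 by rewrite /= addrC addKr.
  have := hf (x + h *: v); rewrite e1 e2 h1 ?h0 // h2 ?h0 // => /(_ isT isT).
  by apply: le_trans; rewrite le_eqVlt; apply/orP; left; apply/eqP; ring.
move=> v; apply/eqP; rewrite eq_le ge andbT.
by have := ge (- v); rewrite linearN /=; lra.
Qed.

End Gradient.

(** * The local potential near the midpoint of an edge *)

Section LocalPotential.
Variables (R : realType) (phi psi : R3 R -> R) (psi0 : R3 R -> R).
Local Notation A := (@Aset R).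
Local Notation B := (@Bset R).
Hypothesis dual : conjugate_pair phi psi.
Hypothesis psiE : forall n, B n -> psi0 n = psi n.
Variables (i j : 'I_4).
Hypothesis ij : i != j.
Local Notation k := (kidx i j).
Local Notation l := (lidx i j).
Local Notation s := (bc (@nv R)).
Local Notation t := (bc (@mv R)).
Local Notation q := (ichart (@nv R) j k l).
Local Notation u := (psi_loc psi0 i j).
Implicit Types (m n : R3 R) (z : R * R).

Definition contact m n := [/\ A m, B n & phi m + psi n = dot m n].

(** On this square both chart coordinates are positive, so the maximum with 0 in [ichart] drops out,
    and the coordinate of index [i] exceeds 1/8, so [ichart] stays on [B]. *)
Definition near_mid z := 3 / 8 < z.1 < 5 / 8 /\ 3 / 8 < z.2 < 5 / 8.

Let uniq_ijkl : uniq [:: i; j; k; l] := uniq4_kl ij.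

Lemma bc_near z : near_mid z ->
  [/\ t i (q z) = 1 - 3 * Num.max z.1 z.2 + z.1 + z.2, t j (q z) = Num.max z.1 z.2,
      t k (q z) = Num.max z.1 z.2 - z.1 & t l (q z) = Num.max z.1 z.2 - z.2].
Proof.
move=> [/andP[? ?] /andP[? ?]].
have e : Num.max 0 (Num.max z.1 z.2) = Num.max z.1 z.2.
  by apply/max_idPr; rewrite le_max; apply/orP; left; lra.
have [-> -> -> ->] := bc_ichart (dual_nm R) z uniq_ijkl.
by rewrite e; split=> //; ring.
Qed.

Lemma near_i_gt0 z : near_mid z -> 0 < t i (q z).
Proof.
move=> hz; have [-> _ _ _] := bc_near hz; move: hz => [/andP[? ?] /andP[? ?]].
by case: (leP z.1 z.2) => ?; lra.
Qed.

Lemma near_B z : near_mid z -> B (q z).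
Proof. by move=> hz; apply: (bdry_ichart (dual_nm R) uniq_ijkl); exact/ltW/near_i_gt0. Qed.

Lemma qchartE n : qchart i j n = chart (@mv R) 1 j k l n.
Proof. by rewrite /qchart /chart /bc; congr pair; field. Qed.

Lemma qmapE z : near_mid z -> qmap i j z = q z.
Proof.
move=> hz; rewrite /qmap; apply: xget_unique => /=.
  split.
    split; first exact: near_B.
    by move=> /(faceE (dual_nm R))[_ ti]; have := near_i_gt0 hz; rewrite ti ltxx.
  by have := chartK (dual_nm R) z uniq_ijkl (oner_neq0 R); rewrite invr1 scale1r qchartE.
move=> n [[Bn nface] e].
have ti : 0 < t i n.
  have /(bdryE (dual_nm R))[n0 _] := Bn; rewrite lt_neqAle n0 andbT eq_sym.
  by apply/eqP => ti; apply: nface; apply/(faceE (dual_nm R)).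
have := ichartK (dual_nm R) uniq_ijkl (oner_neq0 R) Bn ti.
by rewrite -qchartE e invr1 scale1r => <-.
Qed.

Lemma psi_locE z : near_mid z -> u z = psi (q z) - (1 - 4 * Num.max z.1 z.2).
Proof.
move=> hz; rewrite /psi_loc qmapE // psiE; last exact: near_B.
by have [_ <- _ _] := bc_near hz; rewrite /bc; congr (_ - _); field.
Qed.

(** Eliminating [s j m] splits off $\langle m_j,q(z)\rangle=1-4\max(z_1,z_2)$, the function
    subtracted in the local potential. The rest is affine up to a multiple of [s i m]. *)
Lemma dot_near m z : near_mid z -> dot m (q z) = 1 - 4 * Num.max z.1 z.2 +
  4 * (s k m * z.1 + s l m * z.2 + s i m * (4 * Num.max z.1 z.2 - z.1 - z.2 - 1)).
Proof.
move=> hz; rewrite dot_bc (uniq4_sum _ uniq_ijkl); have [-> -> -> ->] := bc_near hz.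
have e : s j m = 1 - s i m - s k m - s l m by have := bc_sum4 (dual_mn R) m uniq_ijkl; lra.
by rewrite e; ring.
Qed.

Lemma contact_le m n n' : contact m n -> B n' -> psi n + (dot m n' - dot m n) <= psi n'.
Proof.
by case: dual => _ _ young _ _ [Am Bn e] Bn'; have := young m n' Am Bn'; lra.
Qed.

Lemma psi_loc_ge m z z' : near_mid z -> near_mid z' -> contact m (q z) ->
  4 * (s k m * (z'.1 - z.1) + s l m * (z'.2 - z.2)
     + s i m * (4 * (Num.max z'.1 z'.2 - Num.max z.1 z.2) - (z'.1 - z.1) - (z'.2 - z.2)))
  <= u z' - u z.
Proof.
move=> hz hz' c; rewrite !psi_locE //; have := contact_le c (near_B hz').
by rewrite !dot_near //; lra.
Qed.

Lemma near_midD z : near_mid z -> exists2 e, 0 < e &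
  forall y, `|y.1 - z.1| < e -> `|y.2 - z.2| < e -> near_mid y.
Proof.
move=> [/andP[? ?] /andP[? ?]].
exists (Num.min (Num.min (z.1 - 3 / 8) (5 / 8 - z.1)) (Num.min (z.2 - 3 / 8) (5 / 8 - z.2))).
  by rewrite !lt_min; apply/andP; split; apply/andP; split; lra.
move=> y; rewrite !lt_min => /andP[/andP[h1 h2] _] /andP[_ /andP[h3 h4]].
move: h1 h2 h3 h4; rewrite !ltr_norml => /andP[? ?] /andP[? ?] /andP[? ?] /andP[? ?].
by split; apply/andP; split; lra.
Qed.

Lemma contact_ge0 m n a : contact m n -> 0 <= s a m.
Proof. by move=> [/(bdryE (dual_mn R))[]]. Qed.

(* The minorant of [psi_loc_ge] has a convex kink of size [s i m] along the diagonal. *)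
Lemma contact_diag_i m z : near_mid z -> z.1 = z.2 -> differentiable u z ->
  contact m (q z) -> s i m = 0.
Proof.
move=> hz zz du c; have [e e0 he] := near_midD hz.
have ge (v : R * R) (b : R) : `|v.1| = 1 -> v.2 = - v.1 -> b = 4 * (s k m * v.1 - s l m * v.1 + 4 * s i m) ->
   b <= 'd u z v.
  move=> v1 v2 bE; apply: (@diff_ge _ _ _ _ _ e du e0) => h /andP[h0 hh].
  have hv : `|h * v.1| < e by rewrite normrM v1 mulr1 gtr0_norm.
  have e1 : (z + h *: v).1 = z.1 + h * v.1 by [].
  have e2 : (z + h *: v).2 = z.2 - h * v.1 by rewrite /= v2 /GRing.scale /= mulrN.
  have hz' : near_mid (z + h *: v).
    by apply: he; [rewrite e1 | rewrite e2]; rewrite addrAC subrr add0r ?normrN.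
  apply: le_trans (psi_loc_ge hz hz' c).
  have mz : Num.max z.1 z.2 = z.1 by rewrite -zz maxxx.
  have mz' : Num.max (z + h *: v).1 (z + h *: v).2 = z.1 + h.
    rewrite e1 e2 -zz; have [v0|v0] := leP 0 v.1.
      rewrite ger0_norm // in v1; rewrite v1 mulr1; apply/max_idPl; lra.
    rewrite ltr0_norm // in v1; rewrite (_ : v.1 = -1); last by lra.
    by rewrite mulrN1 opprK; apply/max_idPr; lra.
  rewrite mz mz' e1 e2 bE le_eqVlt; apply/orP; left; apply/eqP; ring.
(* Both directions leave the diagonal and raise the maximum at unit rate; the two bounds add up to
   [32 * s i m <= 0]. *)
have h1 := ge (1, -1) _ (normr1 _) erefl erefl.
have h2 := ge (- (1, -1)) _ (normrN1 R) erefl erefl.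
by rewrite linearN /= in h2; have := contact_ge0 i c; move: h1 h2 => /=; lra.
Qed.

Lemma diff_contact_diag m z : near_mid z -> z.1 = z.2 -> differentiable u z ->
  contact m (q z) -> s i m = 0 -> forall v, 'd u z v = 4 * s k m * v.1 + 4 * s l m * v.2.
Proof.
move=> hz zz du c si; have [e e0 he] := near_midD hz.
apply: (diff_eq_minorant du e0) => y y1 y2.
by have := psi_loc_ge hz (he y y1 y2) c; rewrite si; lra.
Qed.

Lemma diff_contact_off m z : near_mid z -> z.2 < z.1 -> differentiable u z -> contact m (q z) ->
  forall v, 'd u z v = 4 * (s k m + 3 * s i m) * v.1 + 4 * (s l m - s i m) * v.2.
Proof.
move=> hz zz du c; have [e e0 he] := near_midD hz.
(* Moving each coordinate by less than half the gap keeps the first one the larger, so the minorant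
   is affine there. *)
have d0 : 0 < Num.min e ((z.1 - z.2) / 2) by rewrite lt_min e0 /=; lra.
apply: (diff_eq_minorant du d0) => y; rewrite !lt_min => /andP[y1 h1] /andP[y2 h2].
have := psi_loc_ge hz (he y y1 y2) c.
move: h1 h2; rewrite !ltr_norml => /andP[? ?] /andP[? ?].
rewrite (max_idPl _); last by lra.
by rewrite (max_idPl _); lra.
Qed.

End LocalPotential.

(** * Finite masses and the reflection exchanging two indices *)

Section MassOfBoundarySets.
Variables (R : realType) (v w : 'I_4 -> R3 R) (c : R).
Hypotheses (vw : dual_pair v w) (c0 : c != 0).

Lemma bdry_mass_fin S : S `<=` simplex_boundary v -> closed S ->
  exists2 r, 0 <= r & bdry_mass v w c S = r%:E.
Proof.
move=> Sb cS; exists (fine (bdry_mass v w c S)).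
  by apply: fine_ge0; exact: bdry_mass_ge0.
by rewrite fineK // ge0_fin_numE ?bdry_mass_ge0 // (bdry_mass_lty vw c0).
Qed.

Lemma continuous_permute (s : {perm 'I_4}) : continuous (permute v w s).
Proof.
apply: continuous_lincomb => a; apply: continuous_bc => x; exact: cvg_id.
Qed.

Lemma closed_image (T : topologicalType) (f : T -> R3 R) (K : set T) :
  continuous f -> compact K -> closed (f @` K).
Proof.
move=> cf cK; apply: compact_closed; first exact: norm_hausdorff.
by apply: continuous_compact => //; exact: continuous_subspaceT.
Qed.

Lemma closed_sub_compact (S : set (R3 R)) : S `<=` simplex_boundary v -> closed S -> compact S.
Proof. by move=> Sb cS; apply: (subclosed_compact cS (compact_bdry vw)). Qed.

End MassOfBoundarySets.

Section Reflection.
Variables (R : realType) (i j : 'I_4).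
Local Notation sA := (permute (@mv R) (@nv R) (tperm i j)).
Local Notation sB := (permute (@nv R) (@mv R) (tperm i j)).

Lemma dot_permute (s : {perm 'I_4}) m n :
  dot (permute (@mv R) (@nv R) s m) (permute (@nv R) (@mv R) s n) = dot m n.
Proof.
rewrite !dot_bc [in RHS](reindex_inj (@perm_inj _ s)) /=; congr (1 - 4 * _).
by apply: eq_bigr => a _; rewrite (bc_permute (dual_mn R)) (bc_permute (dual_nm R)).
Qed.

Lemma reflectAK : involutive sA.
Proof. by move=> m; apply: (bc_inj (dual_mn R)) => a; rewrite !(bc_permute (dual_mn R)) tpermK. Qed.

Lemma reflectBK : involutive sB.
Proof. by move=> n; apply: (bc_inj (dual_nm R)) => a; rewrite !(bc_permute (dual_nm R)) tpermK. Qed.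

Lemma dot_reflect m n : dot (sA m) n = dot m (sB n).
Proof. by rewrite -[in LHS](reflectBK n) dot_permute. Qed.

End Reflection.

(** A unit square fits into the chart at index 0: its points have coordinates at most 1/4 at the
    indices 2 and 3, zero at 1, and at least 1/2 at 0. The bound allows the total mass to be
    cancelled in the equation. *)
Lemma muA_gt0 (R : realType) : (1%:E <= @muA R (@Aset R))%E.
Proof.
rewrite muAE; have u : uniq [:: o0; o1; o2; o3] by [].
have c0 : -4 != 0 :> R by rewrite oppr_eq0 pnatr_eq0.
suff h : `[0, 1]%classic `*` `[0, 1]%classic `<=`
    chart (@nv R) (-4) o1 o2 o3 @` (@Aset R `&` reg (@mv R) (@nv R) o0).
  have := le_rect_bdry_mass (dual_mn R) c0 u (@subset_refl _ _) (closed_bdry (dual_mn R))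
    ler01 ler01 h.
  by rewrite subr0 mulr1.
move=> z [/=]; rewrite !in_itv /= => /andP[? ?] /andP[? ?].
have [e0 e1 e2 e3] := bc_ichart (dual_mn R) ((-4)^-1 *: z) u.
have M0 : Num.max 0 (Num.max ((-4)^-1 *: z).1 ((-4)^-1 *: z).2) = 0 :> R.
  apply/max_idPl; rewrite ge_max /GRing.scale /= /GRing.scale /=.
  by apply/andP; split; lra.
rewrite M0 in e0 e1 e2 e3.
have e : ((-4)^-1 *: z).1 = - (z.1 / 4) /\ ((-4)^-1 *: z).2 = - (z.2 / 4).
  by rewrite /GRing.scale /= /GRing.scale /=; split; field.
case: e => f1 f2; rewrite f1 f2 in e0 e2 e3.
exists (ichart (@mv R) o1 o2 o3 ((-4)^-1 *: z)); last exact: (chartK (dual_mn R) z u c0).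
have b : simplex_boundary (@mv R) (ichart (@mv R) o1 o2 o3 ((-4)^-1 *: z)).
  by apply: (bdry_ichart (dual_mn R) u); rewrite e0; lra.
split=> //; split=> // a; case: (ord4P a) => [[[] | ] | ] -> // _; rewrite ?(e1, e2, e3) e0; lra.
Qed.

(** * The equation on closed sets, and strips along an edge *)

Section Transport.
Variables (R : realType) (phi psi psi0 : R3 R -> R).
Local Notation A := (@Aset R).
Local Notation B := (@Bset R).
Hypothesis dual : conjugate_pair phi psi.
Hypothesis psiE : forall n, B n -> psi0 n = psi n.
Local Notation contact := (contact phi psi).

Definition contact_image (E : set (R3 R)) : set (R3 R) := [set m | exists2 n, E n & contact m n].

(** The equation compares proportions, because the charts scale barycentric coordinates by [-4] on
    [A] and by [1] on [B] and the total masses differ. *)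
Hypothesis transport : forall E, closed E -> E `<=` B ->
  (muA (contact_image E) * nuB B = muA A * nuB E)%E.

Lemma closed_A : closed A. Proof. exact: closed_bdry (dual_mn R). Qed.
Lemma closed_B : closed B. Proof. exact: closed_bdry (dual_nm R). Qed.

Lemma contact_image_sub E : contact_image E `<=` A.
Proof. by move=> m [n _ []]. Qed.

(** The contact pairs over [E] form a compact set, of which this is a projection. *)
Lemma closed_contact_image E : closed E -> E `<=` B -> closed (contact_image E).
Proof.
move=> cE EB; case: dual => cphi cpsi _ _ _.
have -> : contact_image E = fst @` ((A `*` E) `&`
   ([set z | phi z.1 + psi z.2 <= dot z.1 z.2] `&` [set z | dot z.1 z.2 <= phi z.1 + psi z.2])).
  apply/seteqP; split=> [m [n En [Am Bn e]]|_ [[m n] [[/= Am En] [h1 h2]] <-]].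
    by exists (m, n) => //; split=> //=; rewrite e.
  by exists n => //; split=> //=; [exact: EB|apply/eqP; rewrite eq_le h1 h2].
have c1 : continuous (fun z : R3 R * R3 R => phi z.1 + psi z.2).
  move=> z; apply: cvgD.
    by apply: (@continuous_comp _ _ _ fst phi); [exact: continuous_fst|exact: cphi].
  by apply: (@continuous_comp _ _ _ snd psi); [exact: continuous_snd|exact: cpsi].
have c2 : continuous (fun z : R3 R * R3 R => dot z.1 z.2).
  by apply: continuous_dot; [exact: continuous_fst|exact: continuous_snd].
apply: closed_image; first exact: continuous_fst.
apply: compact_closedI.
  apply: compact_setX; first exact: compact_bdry (dual_mn R).
  exact: closed_sub_compact (dual_nm R) _ EB cE.
by apply: closedI; exact: closed_le_fun.
Qed.

Let c4 : -4 != 0 :> R. Proof. by rewrite oppr_eq0 pnatr_eq0. Qed.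
Let c1 : 1 != 0 :> R. Proof. exact: oner_neq0. Qed.

Lemma nuB_fin E : E `<=` B -> closed E -> exists2 r, 0 <= r & nuB E = r%:E.
Proof. by rewrite nuBE; exact: (bdry_mass_fin (dual_nm R)). Qed.

Lemma muA_fin E : E `<=` A -> closed E -> exists2 r, 0 <= r & muA E = r%:E.
Proof. by rewrite muAE; exact: (bdry_mass_fin (dual_mn R)). Qed.

Variables (i j : 'I_4).
Hypothesis ij : i != j.
Local Notation k := (kidx i j).
Local Notation l := (lidx i j).
Local Notation s := (bc (@nv R)).
Local Notation t := (bc (@mv R)).
Local Notation q := (ichart (@nv R) j k l).
Local Notation u := (psi_loc psi0 i j).
Let uniq_ijkl : uniq [:: i; j; k; l] := uniq4_kl ij.

Definition diag (y : R) : R * R := (y, y).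

Lemma near_diag y : 3 / 8 < y < 5 / 8 -> near_mid (diag y).
Proof. by []. Qed.

Lemma dot_diag m y : 3 / 8 < y < 5 / 8 -> s i m = 0 -> dot m (q (diag y)) = 1 - 4 * (s j m * y).
Proof.
move=> hy si; rewrite (dot_near ij _ (near_diag hy)) si /= maxxx.
have -> : s k m = 1 - s j m - s l m by have := bc_sum4 (dual_mn R) m uniq_ijkl; lra.
by ring.
Qed.

(** For [z.2 >= 0] near the midpoint, this is the chart value of the point of the face $t_k=0$ with
    $t_i$ equal to [z.1] and $t_l$ equal to [z.2]. The edge $[n_i,n_j]$ is [z.2 = 0]. *)
Definition strip_point (z : R * R) : R * R := (1 - z.1 - z.2, 1 - z.1 - 2 * z.2).

Lemma continuous_strip_point : continuous strip_point.
Proof.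
have ca : continuous (fun z : R * R => 1 - z.1 - z.2).
  move=> z; apply: cvgB; last exact: continuous_snd.
  by apply: cvgB; [exact: cvg_cst|exact: continuous_fst].
have cb : continuous (fun z : R * R => 1 - z.1 - 2 * z.2).
  move=> z; apply: cvgB; last by apply: cvgM; [exact: cvg_cst|exact: continuous_snd].
  by apply: cvgB; [exact: cvg_cst|exact: continuous_fst].
by move=> z; exact: (cvg_pair (ca z) (cb z)).
Qed.

(** [2 * x2 + y2 < 1] means $t_i<t_j$, which puts the strip into the cell of $n_j$. The chart of
    that cell based at [k] reads [(- z.1, - z.2)], so areas are preserved. *)
Lemma le_strip_nuB S (x1 x2 y1 y2 : R) : S `<=` B -> closed S ->
  x1 <= x2 -> y1 <= y2 -> 0 <= y1 -> 3 / 8 < 1 - x2 - 2 * y2 -> 1 - x1 - y1 < 5 / 8 ->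
  2 * x2 + y2 < 1 ->
  (forall z, x1 <= z.1 <= x2 -> y1 <= z.2 <= y2 -> S (q (strip_point z))) ->
  (((x2 - x1) * (y2 - y1))%:E <= nuB S)%E.
Proof.
move=> Sb cS x12 y12 y10 h1 h2 h3 h; rewrite nuBE.
have uj : uniq [:: j; k; i; l].
  move: uniq_ijkl; rewrite /= !inE !negb_or => /and4P[/and3P[nij ik il] /andP[jk jl] kl _].
  by rewrite jk jl kl il (eq_sym j) nij (eq_sym k) ik.
rewrite (_ : (x2 - x1) * (y2 - y1) = (- x1 - (- x2)) * (- y1 - (- y2))); last by ring.
apply: (le_rect_bdry_mass (dual_nm R) c1 uj Sb cS); rewrite ?lerN2 //.
move=> [x y] [/=]; rewrite !in_itv /= => /andP[? ?] /andP[? ?].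
have hz : near_mid (strip_point (- x, - y)) by split=> /=; apply/andP; split; lra.
have [ei ej ek el] := bc_near ij hz.
have M : Num.max (strip_point (- x, - y)).1 (strip_point (- x, - y)).2 = 1 + x + y.
  by rewrite /=; apply/eqP; rewrite eq_le ge_max le_max; apply/andP; split;
    [apply/andP; split; lra | apply/orP; left; lra].
rewrite M /= in ei ej ek el.
exists (q (strip_point (- x, - y))).
  split; first by apply: h; rewrite /=; apply/andP; split; lra.
  split; first exact: near_B.
  move=> a aj; have := uniq4_mem a uniq_ijkl.
  by rewrite !inE (negbTE aj) /= => /or3P[] /eqP ->; rewrite ?(ei, ek, el) ej; lra.
by rewrite /chart ei ek el; congr pair; ring.
Qed.

End Transport.

Lemma mid_bounds (R : realType) : (3 / 8 < 1 / 2 :> R) && (1 / 2 < 5 / 8 :> R).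
Proof. by apply/andP; split; lra. Qed.

Lemma strip_point_near (R : realType) (z : R * R) (h r : R) :
  0 < h -> h < 1 / 16 -> 0 < r -> r <= h / 4 ->
  1 / 2 - h <= z.1 <= 1 / 2 - h + r -> 0 <= z.2 <= r ->
  [/\ near_mid (strip_point z),
      forall e, h < e / 2 -> r <= e / 8 -> ball (diag (1 / 2)) e (strip_point z) &
      forall e, r <= e / 4 -> ball (diag (1 / 2 + h)) e (strip_point z)].
Proof.
move=> h0 h1 r0 r1 /andP[z1 z1'] /andP[z2 z2']; split=> [|e he hr|e hr].
- by split=> /=; apply/andP; split; lra.
- by split; rewrite /ball /= ltr_distl; apply/andP; split; lra.
- by split; rewrite /ball /= ltr_distl; apply/andP; split; lra.
Qed.

(** * Comparison with the reflected potential at the midpoint *)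

Section Midpoint.
Variables (R : realType) (phi psi psi0 : R3 R -> R).
Local Notation A := (@Aset R).
Local Notation B := (@Bset R).
Hypothesis dual : conjugate_pair phi psi.
Hypothesis psiE : forall n, B n -> psi0 n = psi n.
Local Notation contact := (contact phi psi).
Local Notation contact_image := (contact_image phi psi).
Hypothesis transport : forall E, closed E -> E `<=` B ->
  (muA (contact_image E) * nuB B = muA A * nuB E)%E.
Variables (i j : 'I_4).
Hypothesis ij : i != j.
Local Notation k := (kidx i j).
Local Notation l := (lidx i j).
Local Notation s := (bc (@nv R)).
Local Notation t := (bc (@mv R)).
Local Notation q := (ichart (@nv R) j k l).
Local Notation u := (psi_loc psi0 i j).
Local Notation sA := (permute (@mv R) (@nv R) (tperm i j)).
Local Notation sB := (permute (@nv R) (@mv R) (tperm i j)).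
Let uniq_ijkl : uniq [:: i; j; k; l] := uniq4_kl ij.
Let c4 : -4 != 0 :> R. Proof. by rewrite oppr_eq0 pnatr_eq0. Qed.
Let c1 : 1 != 0 :> R. Proof. exact: oner_neq0. Qed.

Lemma continuous_q : continuous q.
Proof. by apply: continuous_ichart => z; exact: cvg_id. Qed.

Lemma reflect_diag (y : R) : 3 / 8 < y < 5 / 8 -> sB (q (diag y)) = q (diag (1 - y)).
Proof.
move=> hy; have hy' : 3 / 8 < 1 - y < 5 / 8 by move: hy => /andP[? ?]; apply/andP; split; lra.
have [ei ej ek el] := bc_near ij (near_diag hy); have [fi fj fk fl] := bc_near ij (near_diag hy').
rewrite /= !maxxx in ei ej ek el fi fj fk fl.
move: uniq_ijkl; rewrite /= !inE !negb_or => /and4P[/and3P[_ ik il] /andP[jk jl] _ _].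
apply: (bc_inj (dual_nm R)) => a; rewrite (bc_permute (dual_nm R)).
have := uniq4_mem a uniq_ijkl; rewrite !inE => /or4P[] /eqP ->.
- by rewrite tpermL ej fi; ring.
- by rewrite tpermR ei fj; ring.
- by rewrite tpermD // ek fk; ring.
- by rewrite tpermD // el fl; ring.
Qed.

(** The kink gives $s_i=0$, the differential gives $s_k$ and $s_l$, and the sum of the coordinates
    gives $s_j$. *)
Lemma contact_mid_unique m m' : differentiable u (diag (1 / 2)) ->
  contact m (q (diag (1 / 2))) -> contact m' (q (diag (1 / 2))) -> m = m'.
Proof.
move=> du c c'; have hz := near_diag (mid_bounds R).
have si := contact_diag_i dual psiE ij hz erefl du c.
have si' := contact_diag_i dual psiE ij hz erefl du c'.
have d := diff_contact_diag dual psiE ij hz erefl du c si.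
have d' := diff_contact_diag dual psiE ij hz erefl du c' si'.
have sk : s k m = s k m' by have := d (1, 0); rewrite d' /=; lra.
have sl : s l m = s l m' by have := d (0, 1); rewrite d' /=; lra.
have sj : s j m = s j m'.
  by have := bc_sum4 (dual_mn R) m uniq_ijkl; have := bc_sum4 (dual_mn R) m' uniq_ijkl; lra.
apply: (bc_inj (dual_mn R)) => a; have := uniq4_mem a uniq_ijkl.
by rewrite !inE => /or4P[] /eqP -> //; rewrite si si'.
Qed.

(* The points touched by a supporting slope that [psi] shares with its reflection
   at some point where the reflection is the larger of the two. *)
Definition shared_slope : set (R3 R) := [set x | exists m, contact m x /\
  exists2 w, B w & psi w <= psi (sB w) /\ phi (sA m) + psi (sB w) = dot m w].

(** A projection of a compact set of triples; the weak inequality in [shared_slope] makes that set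
    closed. *)
Lemma closed_shared_slope : closed shared_slope.
Proof.
case: dual => cphi cpsi _ _ _.
pose T := (R3 R * (R3 R * R3 R))%type.
have -> : shared_slope = fst @` ((B `*` (A `*` B)) `&` (
   [set z : T | phi z.2.1 + psi z.1 <= dot z.2.1 z.1] `&`
   [set z : T | dot z.2.1 z.1 <= phi z.2.1 + psi z.1] `&`
   [set z : T | phi (sA z.2.1) + psi (sB z.2.2) <= dot z.2.1 z.2.2] `&`
   [set z : T | dot z.2.1 z.2.2 <= phi (sA z.2.1) + psi (sB z.2.2)] `&`
   [set z : T | psi z.2.2 <= psi (sB z.2.2)])).
  apply/seteqP; split.
    move=> x [m [[Am Bx e] [w Bw [le e']]]]; exists (x, (m, w)) => //.
    by split=> //; do ![split] => //=; rewrite ?e ?e'.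
  move=> _ [[x [m w]] [[/= Bx [Am Bw]] [[[[/= h1 h2] h3] h4] h5]] <-].
  exists m; split; first by split=> //; apply/eqP; rewrite eq_le h1.
  by exists w => //; split=> //; apply/eqP; rewrite eq_le h3.
have cx : continuous (fun z : T => z.1) by exact: continuous_fst.
have c2 : continuous (fun z : T => z.2) by exact: continuous_snd.
have cm : continuous (fun z : T => z.2.1).
  by move=> z; apply: (@continuous_comp _ _ _ snd fst); [exact: c2|exact: continuous_fst].
have cw : continuous (fun z : T => z.2.2).
  by move=> z; apply: (@continuous_comp _ _ _ snd snd); [exact: c2|exact: continuous_snd].
have comp (V W : topologicalType) (f : T -> V) (g : V -> W) : continuous f -> continuous g ->
    continuous (fun z => g (f z)).
  by move=> cf cg z; apply: (@continuous_comp _ _ _ f g); [exact: cf|exact: cg].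
have cs := @continuous_permute R.
have f1 : continuous (fun z : T => phi z.2.1 + psi z.1).
  by move=> z; apply: cvgD; [exact: (comp _ _ _ _ cm cphi)|exact: (comp _ _ _ _ cx cpsi)].
have f2 : continuous (fun z : T => psi (sB z.2.2)).
  by apply: (comp _ _ (fun z => sB z.2.2)) => //; apply: comp => //; exact: cs.
have f3 : continuous (fun z : T => phi (sA z.2.1) + psi (sB z.2.2)).
  move=> z; apply: cvgD; last exact: f2.
  by apply: (comp _ _ (fun z => sA z.2.1)) => //; apply: comp => //; exact: cs.
have g1 : continuous (fun z : T => dot z.2.1 z.1) by exact: continuous_dot.
have g2 : continuous (fun z : T => dot z.2.1 z.2.2) by exact: continuous_dot.
have g3 : continuous (fun z : T => psi z.2.2) by exact: (comp _ _ _ _ cw cpsi).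
have compA := compact_bdry (dual_mn R); have compB := compact_bdry (dual_nm R).
apply: closed_image; first exact: continuous_fst.
apply: compact_closedI; first by do ![apply: compact_setX].
by do ![apply: closedI]; exact: closed_le_fun.
Qed.

(** If the slope were shared through [w], then [phi (sA m) = dot m w - psi (sB w) <= dot m w - psi w
    <= phi m]. As the midpoint is fixed by [sB], the slope [sA m] would touch there too, and
    uniqueness would give [sA m = m], so [s j m = s i m = 0]. *)
Lemma mid_shared_slope m : differentiable u (diag (1 / 2)) ->
  contact m (q (diag (1 / 2))) -> s j m != 0 -> ~ shared_slope (q (diag (1 / 2))).
Proof.
move=> du c sj [m' [c' [w Bw [le e]]]].
have mm := contact_mid_unique du c' c; subst m'.
have sp : sB (q (diag (1 / 2))) = q (diag (1 / 2)).
  by rewrite reflect_diag ?mid_bounds // (_ : 1 - 1 / 2 = 1 / 2) //; lra.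
have : contact (sA m) (q (diag (1 / 2))).
  case: dual c => _ _ young _ _ [Am Bp e'].
  have AsA : A (sA m) by exact/(permute_bdry (dual_mn R)).
  split=> //; have := young _ _ AsA Bp; have := young _ _ Am Bw.
  by rewrite (dot_reflect i j m) sp; lra.
move=> /(contact_mid_unique du c) e'; move: sj; apply/negP/negPn/eqP.
have := contact_diag_i dual psiE ij (near_diag (mid_bounds R)) erefl du c.
by rewrite {1}e' (bc_permute (dual_mn R)) tpermL.
Qed.

(** Otherwise psi at [1/2 + h] is at least psi at [1/2 - h], hence at least the supporting value
    there. The derivative of [u] along the edge would then be at least [4 * s j m + 4], whereas it
    equals [4 * (s k m + s l m)], that is [4 - 4 * s j m]. *)
Lemma reflection_gt m e : differentiable u (diag (1 / 2)) -> 0 < e < 1 / 8 ->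
  contact m (q (diag (1 / 2))) -> 0 < s j m ->
  exists2 h, 0 < h < e & psi (q (diag (1 / 2 + h))) < psi (q (diag (1 / 2 - h))).
Proof.
move=> du /andP[e0 e1] c sj; apply: contrapT => /forall2NP hn.
have hz := near_diag (mid_bounds R).
have si := contact_diag_i dual psiE ij hz erefl du c.
have : 4 * s j m + 4 <= 'd u (diag (1 / 2)) (1, 1).
  apply: (diff_ge du e0) => h he; have [h0 h1] := andP he.
  have hp : 3 / 8 < 1 / 2 + h < 5 / 8 by apply/andP; split; lra.
  have hm : 3 / 8 < 1 / 2 - h < 5 / 8 by apply/andP; split; lra.
  have -> : diag (1 / 2) + h *: (1, 1) = diag (1 / 2 + h).
    by rewrite /diag; congr pair; rewrite /= /GRing.scale /= mulr1.
  rewrite (psi_locE psiE ij (near_diag hp)) (psi_locE psiE ij hz).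
  have := contact_le dual c (near_B ij (near_diag hm)).
  rewrite (dot_diag ij hm si) (dot_diag ij (mid_bounds R) si) /= !maxxx.
  by have [//|/negP] := hn h; rewrite -leNgt; lra.
rewrite (diff_contact_diag dual psiE ij hz erefl du c si) /=.
by have := bc_sum4 (dual_mn R) m uniq_ijkl; lra.
Qed.

(** Let [m] be a slope of the reflected potential at [w] in [E], and let it touch [psi] at [x].
    Adding the Young inequalities for [m], [w] and for [sA m], [sB x] gives [psi (sB x) - psi x >=
    psi (sB w) - psi w >= d]. So [x] lies in [E] and has a shared slope. Since reflection preserves
    both measures, the equation turns this inclusion of slope sets into the inequality. *)
Lemma reflection_mass (E : set (R3 R)) (d : R) : 0 < d -> closed E -> E `<=` B ->
  (forall n, E n <-> B n /\ psi n + d <= psi (sB n)) ->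
  (nuB E <= nuB (E `&` shared_slope))%E.
Proof.
move=> d0 cE EB EE; case: (dual) => cphi cpsi young attA attB.
have XB : E `&` shared_slope `<=` B by move=> x [/EB].
have cX : closed (E `&` shared_slope) by apply: closedI => //; exact: closed_shared_slope.
have sEB : sB @` E `<=` B.
  by move=> _ [x /EB Bx <-]; exact/(permute_bdry (dual_nm R)).
have csE : closed (sB @` E).
  apply: closed_image; first exact: continuous_permute.
  exact: closed_sub_compact (dual_nm R) _ EB cE.
have cY := closed_contact_image dual csE sEB.
have cY' := closed_contact_image dual cX XB.
have YA := @contact_image_sub _ phi psi (sB @` E).
have YA' := @contact_image_sub _ phi psi (E `&` shared_slope).
have sub : sA @` contact_image (sB @` E) `<=` contact_image (E `&` shared_slope).
  move=> _ [m1 [_ [w Ew <-] [Am1 _ e]] <-]; set m := sA m1.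
  have Am : A m by exact/(permute_bdry (dual_mn R)).
  have Bw := EB _ Ew; have [_ dw] := (EE w).1 Ew.
  have [x Bx ex] := attA _ Am.
  have mE : sA m = m1 by rewrite /m reflectAK.
  have ew : phi (sA m) + psi (sB w) = dot m w by rewrite mE e /m dot_reflect.
  have BsB : B (sB x) by exact/(permute_bdry (dual_nm R)).
  have y1 := young m w Am Bw; have y2 := young m1 (sB x) Am1 BsB.
  rewrite -dot_reflect -/m -mE in y2.
  have Ex : E x by apply/EE; split=> //; lra.
  exists x; last by split.
  split=> //; exists m; split; first by split.
  by exists w => //; split=> //; lra.
have cS : closed (sA @` contact_image (sB @` E)).
  apply: closed_image; first exact: continuous_permute.
  exact: closed_sub_compact (dual_mn R) _ YA cY.
have le1 : (muA (contact_image (sB @` E)) <= muA (contact_image (E `&` shared_slope)))%E.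
  rewrite !muAE -(bdry_mass_permute (dual_mn R) c4 (tperm i j) YA cY).
  exact: (le_bdry_mass (dual_mn R) c4).
have e1 := transport csE sEB; have e2 := transport cX XB.
have e3 : nuB (sB @` E) = nuB E.
  by rewrite !nuBE (bdry_mass_permute (dual_nm R) c1).
rewrite e3 in e1.
have [a a0 ea] := muA_fin (@subset_refl _ A) (@closed_A R).
have [b b0 eb] := nuB_fin (@subset_refl _ B) (@closed_B R).
have [y y0 ey] := muA_fin YA cY; have [y' y0' ey'] := muA_fin YA' cY'.
have [n n0 en] := nuB_fin EB cE; have [n' n0' en'] := nuB_fin XB cX.
have a1 := muA_gt0 R.
move: e1 e2 le1 a1; rewrite ea eb ey ey' en en' -!EFinM !lee_fin => -[e1] [e2] le1 a1.
rewrite -(@ler_pM2l _ a); last by lra.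
by rewrite -e1 -e2 ler_wpM2r.
Qed.

(** If [s j m > 0], some strip [W] close to the midpoint lies in [E] and avoids [shared_slope]. Its
    positive mass contradicts [reflection_mass]. *)
Lemma contact_mid_j m : differentiable u (diag (1 / 2)) ->
  contact m (q (diag (1 / 2))) -> s j m = 0.
Proof.
move=> du c; apply/eqP; apply: contrapT => /negP sj.
have sj0 : 0 < s j m by rewrite lt_neqAle eq_sym sj (contact_ge0 _ c).
have cpsi : continuous psi by case: dual.
have nZ := mid_shared_slope du c sj.
have oZ : open (q @^-1` (~` shared_slope)).
  apply: open_comp; first by move=> z _; exact: continuous_q.
  by apply: closed_openC; exact: closed_shared_slope.
have /nbhs_ballP[e /= e0 he] : nbhs (diag (1 / 2)) (q @^-1` (~` shared_slope)).
  exact: open_nbhs_nbhs.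
(* Half of the ball is left for the width of the strip; 1/16 is the range of [strip_point_near]. *)
have [e' e'0 [h1 h2]] : exists2 e', 0 < e' & e' <= e / 2 /\ e' <= 1 / 16.
  exists (Num.min (e / 2) (1 / 16)); last by rewrite !ge_min !lexx orbT.
  by rewrite lt_min; apply/andP; split; lra.
have [h /andP[h0 he'] hlt] : exists2 h, 0 < h < e' &
    psi (q (diag (1 / 2 + h))) < psi (q (diag (1 / 2 - h))).
  by apply: (reflection_gt du _ c sj0); apply/andP; split; lra.
have hp : 3 / 8 < 1 / 2 + h < 5 / 8 by apply/andP; split; lra.
have [d d0 hd] : exists2 d, 0 < d & psi (q (diag (1 / 2 + h))) + d < psi (sB (q (diag (1 / 2 + h)))).
  rewrite reflect_diag // (_ : 1 - (1 / 2 + h) = 1 / 2 - h); last by lra.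
  (* Half the gap, so that the inequality with margin [d] stays strict and persists on a
     neighbourhood. *)
  exists ((psi (q (diag (1 / 2 - h))) - psi (q (diag (1 / 2 + h)))) / 2); lra.
have csB : continuous (fun n => psi (sB n)).
  by move=> n; apply: (@continuous_comp _ _ _ sB psi); [exact: continuous_permute|exact: cpsi].
pose E := B `&` [set n | psi n + d <= psi (sB n)].
have cE : closed E.
  apply: closedI; first exact: closed_B.
  apply: closed_le_fun => // n; apply: cvgD; [exact: cpsi|exact: cvg_cst].
have EB : E `<=` B by move=> n [].
have := reflection_mass d0 cE EB (fun n => iff_refl _).
have oD : open [set z | psi (q z) + d < psi (sB (q z))].
  apply: open_lt_fun => z.
    apply: cvgD; last exact: cvg_cst.
    by apply: (@continuous_comp _ _ _ q psi); [exact: continuous_q|exact: cpsi].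
  by apply: (@continuous_comp _ _ _ q (fun n => psi (sB n))); [exact: continuous_q|exact: csB].
have /nbhs_ballP[r /= r0 hr] : nbhs (diag (1 / 2 + h)) [set z | psi (q z) + d < psi (sB (q z))].
  exact: open_nbhs_nbhs.
have [r' r'0 [f1 f2 f3]] : exists2 r', 0 < r' & [/\ r' <= r / 4, r' <= h / 4 & r' <= e / 8].
  exists (Num.min (Num.min (r / 4) (h / 4)) (e / 8)); last by rewrite !ge_min !lexx !orbT.
  by rewrite !lt_min; apply/andP; split; [apply/andP; split|]; lra.
pose rect : set (R * R) := `[1 / 2 - h, 1 / 2 - h + r']%classic `*` `[0, r']%classic.
pose W := (fun z => q (strip_point z)) @` rect.
have inW z : rect z -> [/\ near_mid (strip_point z), ball (diag (1 / 2)) e (strip_point z) &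
    ball (diag (1 / 2 + h)) r (strip_point z)].
  move=> [/=]; rewrite !in_itv /= => z1 z2.
  have [nz bz bz'] := strip_point_near h0 (lt_le_trans he' h2) r'0 f2 z1 z2.
  by split; [exact: nz | apply: bz => //; exact: lt_le_trans h1 | exact: bz'].
have WE : W `<=` E.
  move=> _ [z /inW[hz _ hz'] <-]; split; first exact: near_B.
  exact/ltW/hr.
have cW : closed W.
  have cqs : continuous (fun z => q (strip_point z)).
    by apply: continuous_ichart; exact: continuous_strip_point.
  exact: (closed_image cqs (compact_setX (@segment_compact _ _ _) (@segment_compact _ _ _))).
have WX : (E `&` shared_slope) `&` W = set0.
  apply/seteqP; split=> // x [[_ sh] [z /inW[_ hz _] e1]].
  by apply: (he _ hz); rewrite /= e1.
have cX : closed (E `&` shared_slope) by apply: closedI => //; exact: closed_shared_slope.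
have lW : ((r' * r')%:E <= nuB W)%E.
  have := @le_strip_nuB _ _ _ ij W (1 / 2 - h) (1 / 2 - h + r') 0 r' (subset_trans WE EB) cW.
  rewrite (_ : (1 / 2 - h + r' - (1 / 2 - h)) * (r' - 0) = r' * r'); last by ring.
  apply; try lra.
  move=> z hz1 hz2; exists z => //; by split; rewrite /= in_itv /=.
have := bdry_massD (dual_nm R) c1 EB cX cW cE (@subIsetl _ _ _) WE WX.
rewrite -!nuBE.
have [n n0 en] := nuB_fin EB cE.
have [n' n0' en'] := nuB_fin (subset_trans (@subIsetl _ _ _) EB) cX.
have [y y0 ey] := nuB_fin (subset_trans WE EB) cW.
move: lW; rewrite en en' ey -EFinD !lee_fin => lW le1 le2.
have : 0 < r' * r' by rewrite mulr_gt0.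
by lra.
Qed.

End Midpoint.

Lemma half_edge_bounds (R : realType) (x r : R) : 0 < r -> 4 * r <= 1 / 8 ->
  r <= 1 / 2 - x <= 2 * r ->
  [/\ `|1 - x - 1 / 2| < 4 * r, 0 <= 1 / 2 - x < 1 / 8 & 3 / 8 < 1 - x < 5 / 8].
Proof.
move=> r0 r1 /andP[x1 x2]; split; last 2 first; try by apply/andP; split; lra.
by rewrite ltr_norml; apply/andP; split; lra.
Qed.

Lemma half_strip_bounds (R : realType) (z : R * R) (r d : R) :
  0 < r -> 4 * r <= 1 / 8 -> 0 < d -> d <= r / 8 ->
  1 / 2 - 2 * r <= z.1 <= 1 / 2 - r -> d <= z.2 <= 2 * d ->
  [/\ near_mid (strip_point z), (strip_point z).2 < (strip_point z).1,
      `|(strip_point z).1 - 1 / 2| < 4 * r, `|(strip_point z).2 - 1 / 2| < 4 * r &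
      r <= 1 / 2 - z.1 <= 2 * r].
Proof.
move=> r0 r1 d0 dr /andP[z1 z1'] /andP[z2 z2']; split.
- by split=> /=; apply/andP; split; lra.
- by rewrite /=; lra.
- by rewrite ltr_norml /=; apply/andP; split; lra.
- by rewrite ltr_norml /=; apply/andP; split; lra.
- by apply/andP; split; lra.
Qed.

(** * The half edge of constant gradient and the mass contradiction *)

Section NonLipschitz.
Variables (R : realType) (phi psi psi0 : R3 R -> R).
Local Notation A := (@Aset R).
Local Notation B := (@Bset R).
Hypothesis dual : conjugate_pair phi psi.
Hypothesis psiE : forall n, B n -> psi0 n = psi n.
Local Notation contact := (contact phi psi).
Local Notation contact_image := (contact_image phi psi).
Hypothesis transport : forall E, closed E -> E `<=` B ->
  (muA (contact_image E) * nuB B = muA A * nuB E)%E.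
Variables (i j : 'I_4).
Hypothesis ij : i != j.
Local Notation k := (kidx i j).
Local Notation l := (lidx i j).
Local Notation s := (bc (@nv R)).
Local Notation t := (bc (@mv R)).
Local Notation q := (ichart (@nv R) j k l).
Local Notation u := (psi_loc psi0 i j).
Let uniq_ijkl : uniq [:: i; j; k; l] := uniq4_kl ij.
Let c4 : -4 != 0 :> R. Proof. by rewrite oppr_eq0 pnatr_eq0. Qed.

(** Since [s i m = s j m = 0], the pairing with [m] is constantly 1 along the edge, so psi is least
    at the midpoint among these edge points. A slope [m'] at [1/2 + h] gives back [psi] at the
    midpoint [>= psi] at [1/2 + h] plus [4 * s j m' * h]. The sign of this term is what selects the
    half [h >= 0]. *)
Lemma contact_half_edge m (h : R) : differentiable u (diag (1 / 2)) ->
  contact m (q (diag (1 / 2))) -> 0 <= h < 1 / 8 -> differentiable u (diag (1 / 2 + h)) ->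
  contact m (q (diag (1 / 2 + h))).
Proof.
move=> du c /andP[h0 h1] duh.
have hp : 3 / 8 < 1 / 2 + h < 5 / 8 by apply/andP; split; lra.
have hz := near_diag (mid_bounds R); have hz' := near_diag hp.
have si := contact_diag_i dual psiE ij hz erefl du c.
have sj := contact_mid_j dual psiE transport ij du c.
case: (dual) => _ _ young _ attB.
have [m' Am' e'] := attB _ (near_B ij hz').
have c' : contact m' (q (diag (1 / 2 + h))) by split=> //; exact: near_B.
have si' := contact_diag_i dual psiE ij hz' erefl duh c'.
have := contact_le dual c' (near_B ij hz).
have := contact_le dual c (near_B ij hz').
case: c => Am Bp e.
rewrite !(dot_diag ij hp) // !(dot_diag ij (mid_bounds R)) // sj => le1 le2.
rewrite (dot_diag ij (mid_bounds R)) // sj in e.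
split=> //; first exact: near_B.
rewrite (dot_diag ij hp) // sj.
have : 0 <= s j m' * h by rewrite mulr_ge0 // (contact_ge0 _ c').
by lra.
Qed.

(* On each face of [A] the four coordinates are affine functions of the two
   components [4 (s k + 3 s i)] and [4 (s l - s i)] of the gradient. *)
Lemma face_gradient_inj m m' b (x y e : R) : s b m = 0 -> s b m' = 0 ->
  `|s k m + 3 * s i m - x| <= e -> `|s l m - s i m - y| <= e ->
  `|s k m' + 3 * s i m' - x| <= e -> `|s l m' - s i m' - y| <= e ->
  forall a, `|s a m - s a m'| <= 16 * e.
Proof.
rewrite !ler_norml => mb mb' /andP[? ?] /andP[? ?] /andP[? ?] /andP[? ?] a.
have := bc_sum4 (dual_mn R) m uniq_ijkl; have := bc_sum4 (dual_mn R) m' uniq_ijkl.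
have := uniq4_mem a uniq_ijkl; have := uniq4_mem b uniq_ijkl; rewrite !inE.
(* Solving for the coordinates costs at most [10 * e] on the worst face; 16 leaves room. *)
by move=> /or4P[] /eqP eb /or4P[] /eqP ->; rewrite eb in mb mb' => ? ?;
  rewrite ler_norml; apply/andP; split; lra.
Qed.

(** The gradient determines a slope only within one face, so the box bound takes one centre per
    face. The number 256 is 4 times [|c| = 4] times the 16 of [face_gradient_inj]. *)
Lemma muA_gradient_box (S : set (R3 R)) (x y e : R) : 0 <= e -> S `<=` A -> closed S ->
  (forall m, S m -> `|s k m + 3 * s i m - x| <= e /\ `|s l m - s i m - y| <= e) ->
  (muA S <= (16 * (256 * e) ^+ 2)%:E)%E.
Proof.
move=> e0 SA cS hS; rewrite muAE.
have e16 : 0 <= 16 * e by lra.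
have := bdry_mass_box (dual_mn R) c4
  (z := fun b a => s a (xget (pt 0 0 0) [set m | S m /\ s b m = 0])) e16 SA cS.
rewrite normrN (@ger0_norm _ 4) // (_ : 4 * 4 * (16 * e) = 256 * e); last by ring.
apply=> m Sm; have /(bdryE (dual_mn R))[_ [b mb]] := SA _ Sm.
(* The default of [xget] is excluded, since [m] itself is a point of [S] on the face [b]. *)
exists b => a; case: xgetP => [m' _ [Sm' mb']|/(_ m)[]//].
have [h1 h2] := hS _ Sm; have [h3 h4] := hS _ Sm'.
exact: (face_gradient_inj mb mb' h1 h2 h3 h4).
Qed.

Lemma dist_strip (z : R * R) : 0 <= z.2 -> `|strip_point z - diag (1 - z.1)| <= 2 * z.2.
Proof.
move=> z0; rewrite prod_normE /= ge_max.
rewrite (_ : 1 - z.1 - z.2 - (1 - z.1) = - z.2); last by ring.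
rewrite (_ : 1 - z.1 - 2 * z.2 - (1 - z.1) = - (2 * z.2)); last by ring.
by rewrite !normrN !ger0_norm ?mulr_ge0 //; apply/andP; split; lra.
Qed.

Lemma not_lipschitz_gradient_mid (r : R) : 0 < r ->
  ~ lipschitz_gradient_near u (diag (1 / 2)) r.
Proof.
move=> r0 [L [du lip]].
have [r1 r10 [f1 f2]] : exists2 r1, 0 < r1 & 4 * r1 <= r /\ 4 * r1 <= 1 / 8.
  exists (Num.min r (1 / 8) / 4); first by rewrite divr_gt0 // lt_min r0 /=; lra.
  by rewrite mulrCA divff ?mulr1 ?ge_min ?lexx ?orbT.
have inball (z : R * R) : `|z.1 - 1 / 2| < 4 * r1 -> `|z.2 - 1 / 2| < 4 * r1 ->
    ball (diag (1 / 2)) r z.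
  by move=> z1 z2; split; rewrite /ball /= distrC; exact: lt_le_trans f1.
have ballz : ball (diag (1 / 2)) r (diag (1 / 2)) by exact: ballxx.
case: (dual) => _ _ _ _ attB.
have hz := near_diag (mid_bounds R).
have [m0 Am0 e0] := attB _ (near_B ij hz).
have c0 : contact m0 (q (diag (1 / 2))) by split=> //; exact: near_B.
have si0 := contact_diag_i dual psiE ij hz erefl (du _ ballz) c0.
have [a a0 ea] := muA_fin (@subset_refl _ A) (@closed_A R).
have [b b0 eb] := nuB_fin (@subset_refl _ B) (@closed_B R).
have a1 : 1 <= a by rewrite -lee_fin -ea; exact: muA_gt0.
pose C := 16 * (256 * `|L|) ^+ 2 * b.
have C0 : 0 <= C by rewrite !mulr_ge0 ?ler0n ?sqr_ge0.
have C1 : 0 < C + 1 by lra.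
(* This choice gives [(C + 1) * d <= a * r1], against the bound [a * r1 <= C * d] obtained from the
   masses. *)
have [d d0 [d1 d2]] : exists2 d, 0 < d & d <= r1 / 8 /\ d <= a * r1 / (C + 1).
  exists (Num.min (r1 / 8) (a * r1 / (C + 1))); last by rewrite !ge_min !lexx orbT.
  rewrite lt_min; apply/andP; split; first by lra.
  by rewrite divr_gt0 // mulr_gt0 //; exact: lt_le_trans a1.
(* [z.2 >= d] keeps the strip off the edge, so that [diff_contact_off] applies; [z.1 <= 1/2 - r1]
   puts it alongside the half edge towards $n_j$. *)
pose rect : set (R * R) := `[1 / 2 - 2 * r1, 1 / 2 - r1]%classic `*` `[d, 2 * d]%classic.
pose E := (fun z => q (strip_point z)) @` rect.
have rectE z : rect z -> [/\ near_mid (strip_point z), (strip_point z).2 < (strip_point z).1,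
    ball (diag (1 / 2)) r (strip_point z), d <= z.2 <= 2 * d & r1 <= 1 / 2 - z.1 <= 2 * r1].
  move=> [/=]; rewrite !in_itv /= => z1 z2.
  have [nz off b1 b2 hz1] := half_strip_bounds r10 f2 d0 d1 z1 z2.
  by split=> //; exact: inball.
have EB : E `<=` B by move=> _ [z /rectE[hz' _ _ _ _] <-]; exact: near_B.
have cE : closed E.
  have cqs : continuous (fun z => q (strip_point z)).
    by apply: continuous_ichart; exact: continuous_strip_point.
  exact: (closed_image cqs (compact_setX (@segment_compact _ _ _) (@segment_compact _ _ _))).
have grad m : contact_image E m -> `|s k m + 3 * s i m - s k m0| <= `|L| * d /\
    `|s l m - s i m - s l m0| <= `|L| * d.
  move=> [_ [z /rectE[hz' off bz /andP[z2 z2'] hz1] <-] c].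
  have [h1 h2 hp] := half_edge_bounds r10 f2 hz1.
  have hh : 1 / 2 + (1 / 2 - z.1) = 1 - z.1 by lra.
  have bh : ball (diag (1 / 2)) r (diag (1 - z.1)).
    exact: inball.
  have ch : contact m0 (q (diag (1 - z.1))).
    have := @contact_half_edge m0 (1 / 2 - z.1) (du _ ballz) c0; by rewrite hh; apply=> //; exact: du.
  have g1 := diff_contact_off dual psiE ij hz' off (du _ bz) c.
  have g2 := diff_contact_diag dual psiE ij (near_diag hp) erefl (du _ bh) ch si0.
  (* The strip point is within [2 * z.2 <= 4 * d] of the edge point. The factor 4 cancels later
     against the one in both differentials, and [|L|] covers a negative [L]. *)
  have le (v : R * R) (x y : R) : `|v| <= 1 -> 'd u (strip_point z) v = x ->
      'd u (diag (1 - z.1)) v = y -> `|x - y| <= 4 * (`|L| * d).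
    move=> v1 <- <-; apply: le_trans (lip _ _ v bz bh) _.
    have dz : `|strip_point z - diag (1 - z.1)| <= 4 * d.
      by apply: le_trans (dist_strip _) _; lra.
    rewrite (_ : 4 * (`|L| * d) = `|L| * (4 * d) * 1); last by ring.
    apply: (@le_trans _ _ (`|L| * `|strip_point z - diag (1 - z.1)| * `|v|)).
      by rewrite !ler_wpM2r // ler_norm.
    by apply: ler_pM; rewrite ?mulr_ge0 ?ler_wpM2l.
  have n1 : `|(1, 0) : R * R| <= 1 by rewrite prod_normE /= normr1 normr0 ge_max lexx ler01.
  have n2 : `|(0, 1) : R * R| <= 1 by rewrite prod_normE /= normr1 normr0 ge_max lexx ler01.
  have l1 := le _ _ _ n1 (g1 _) (g2 _); have l2 := le _ _ _ n2 (g1 _) (g2 _).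
  move: l1 l2; rewrite /= !mulr0 !mulr1 !addr0 !add0r -!mulrBr !normrM.
  by rewrite (@ger0_norm _ 4) // !ler_pM2l // => ? ?; split.
have Ld : 0 <= `|L| * d by rewrite mulr_ge0 // ltW.
have up := muA_gradient_box Ld (@contact_image_sub _ _ _ E) (closed_contact_image dual cE EB) grad.
have low : ((r1 * d)%:E <= nuB E)%E.
  have := @le_strip_nuB _ _ _ ij E (1 / 2 - 2 * r1) (1 / 2 - r1) d (2 * d) EB cE.
  rewrite (_ : (1 / 2 - r1 - (1 / 2 - 2 * r1)) * (2 * d - d) = r1 * d); last by ring.
  apply; try lra.
  by move=> z hz1 hz2; exists z => //; split; rewrite /= in_itv.
have [y y0 ey] := muA_fin (@contact_image_sub _ _ _ E) (closed_contact_image dual cE EB).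
have [n n0 en] := nuB_fin EB cE.
have := transport cE EB; move: up low; rewrite ea eb ey en -!EFinM !lee_fin => up low [e].
have h1 : a * (r1 * d) <= a * n by rewrite ler_wpM2l.
have h2 : y * b <= C * d ^+ 2.
  rewrite (_ : C * d ^+ 2 = 16 * (256 * (`|L| * d)) ^+ 2 * b); last by rewrite /C; ring.
  by rewrite ler_wpM2r.
have h3 : a * r1 <= C * d.
  rewrite -(ler_pM2r d0); apply: (@le_trans _ _ (a * n)); first by rewrite -mulrA.
  by rewrite -e -mulrA -expr2.
have h4 : (C + 1) * d <= a * r1 by rewrite mulrC -ler_pdivlMr.
by lra.
Qed.

End NonLipschitz.

(** * The singular point in the chart, and the conclusion *)

Lemma bc_vertex (R : realType) (a b : 'I_4) : bc (@mv R) a (nv R b) = (a == b)%:R.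
Proof.
have [e0 e1 e2 e3] := bc_mvE (nv R b).
by case: (ord4P a) => [[[] | ] | ] ->; rewrite ?(e0, e1, e2, e3);
  case: (ord4P b) => [[[] | ] | ] ->; rewrite /=; lra.
Qed.

Lemma qchart_nmid (R : realType) (i j : 'I_4) : i != j ->
  qchart i j (nmid R i j) = diag (1 / 2 : R).
Proof.
move=> ij; have := uniq4_kl ij.
rewrite /= !inE !negb_or => /and4P[/and3P[_ ik il] /andP[jk jl] kl _].
have e a : bc (@mv R) a (nmid R i j) = ((a == i)%:R + (a == j)%:R) / 2.
  by rewrite -!bc_vertex /bc /dot /nmid /=; field.
have ne (x y : 'I_4) : x != y -> (y == x) = false by rewrite eq_sym; exact: negbTE.
rewrite qchartE /chart !e eqxx (ne _ _ ij) (ne _ _ ik) (ne _ _ il) (ne _ _ jk) (ne _ _ jl).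
by rewrite /diag; congr pair; rewrite /=; field.
Qed.

Unset Implicit Arguments.

Theorem theorem1p2 (R : realType) (psi : R3 R -> R) :
  boundedOn (@Bset R) psi ->
  c_convexB psi ->
  (forall E : set (R3 R), closed E -> E `<=` @Bset R ->
     (MAmeas psi E * nuB (@Bset R) = muA (@Aset R) * nuB E)%E) ->
  forall i j : 'I_4, i != j ->
    forall r : R, 0 < r ->
      ~ lipschitz_gradient_near (psi_loc psi i j) (qchart i j (nmid R i j)) r.
Proof.
move=> bpsi cpsi MA i j ij r r0; rewrite (qchart_nmid _ ij).
have dual := conjugate_pair_ct bpsi cpsi.
apply: (not_lipschitz_gradient_mid dual _ _ ij r0) => [n Bn|E cE EB].
  by rewrite cpsi.
(* [c_subdiff] already involves the double conjugate, so its contact pairs are those of the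
   conjugate pair. *)
have <- : [set m | @Aset R m /\ exists n, E n /\ c_subdiff (ctB psi) m n] =
    contact_image (ctB psi) (ctA (ctB psi)) E.
  apply/seteqP; split=> [m [Am [n [En [Bn e]]]]|m [n En [Am Bn e]]]; first by exists n.
  by split=> //; exists n.
exact: MA.
Qed.
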